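(* Let $D>0$ be an integer, and let $A$ be a finitely presented connected graded algebra over a field $k$. Then the set of Hilbert series of homogeneous right-sided ideals in $A$ having generators and relations in degrees at most $D$ is finite.
   Context: A connected graded algebra over $k$ is an associative algebra $A=\bigoplus_{i\ge 0}A_i$ with $A_0=k$; it is finitely presented if it has finitely many generators and finitely many relations. All ideals are graded. A right ideal $I$ has generators in degrees at most $D$ if $\mathrm{Tor}_0^A(I,k)_j=0$ for $j>D$, and relations in degrees at most $D$ if $\mathrm{Tor}_1^A(I,k)_j=0$ for $j>D$. The Hilbert series of a locally finite graded vector space $V$ is $V(z)=\sum_i(\dim_k V_i)z^i$. *)

(* Defs.v *)
From mathcomp Require Import all_boot all_algebra.
From mathcomp Require Import boolp classical_sets functions cardinality.
From mathcomp Require Import monalg.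

Set Implicit Arguments.
Unset Strict Implicit.
Unset Printing Implicit Defensive.

Import GRing.Theory.
Local Open Scope classical_set_scope.
Local Open Scope ring_scope.

(* V is the internal direct sum of the additive subgroups G 0, G 1, ... *)
Record is_grading (V : zmodType) (G : nat -> set V) : Prop := IsGrading {
  grading0 : forall i, G i 0;
  gradingB : forall i x y, G i x -> G i y -> G i (x - y);
  grading_sum : forall x, exists (N : nat) (c : nat -> V),
    (forall i, G i (c i)) /\ x = \sum_(i < N) c i;
  grading_direct : forall (N : nat) (c : nat -> V), (forall i, G i (c i)) ->
    \sum_(i < N) c i = 0 -> forall i, (i < N)%N -> c i = 0 }.

Record connected_graded (k : fieldType) (A : algType k) (G : nat -> set A)
  : Prop := ConnectedGraded {
  connected_graded_grading : is_grading G;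
  connected_gradedZ : forall i (a : k) x, G i x -> G i (a *: x);
  connected_gradedM : forall i j x y, G i x -> G j y -> G (i + j)%N (x * y);
  connected_graded_deg0 : G 0%N = range (fun a : k => a%:A) }.

(* {malg k[{fmonom 'I_n}]} is the free associative algebra on n generators;
   the kernel of phi is the two-sided ideal generated by the relations r. *)
Definition finitely_presented (k : fieldType) (A : algType k) : Prop :=
  exists (n : nat) (phi : {lrmorphism {malg k[{fmonom 'I_n}]} -> A})
         (m : nat) (r : 'I_m -> {malg k[{fmonom 'I_n}]}),
    range phi = setT /\
    forall p, phi p = 0 <->
      exists (N : nat) (l : 'I_N -> 'I_m)
             (u v : 'I_N -> {malg k[{fmonom 'I_n}]}),
        p = \sum_(i < N) u i * r (l i) * v i.

Record graded_right_ideal (k : fieldType) (A : algType k) (G : nat -> set A)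
  (I : set A) : Prop := GradedRightIdeal {
  right_ideal0 : I 0;
  right_idealD : forall x y, I x -> I y -> I (x + y);
  right_idealM : forall x a, I x -> I (x * a);
  right_ideal_graded : forall x, I x -> exists (N : nat) (c : nat -> A),
    (forall i, G i (c i) /\ I (c i)) /\ x = \sum_(i < N) c i }.

Definition has_dim (k : fieldType) (V : lmodType k) (W : set V) (d : nat)
  : Prop :=
  exists b : 'I_d -> V,
    W = range (fun c : 'I_d -> k => \sum_(i < d) c i *: b i) /\
    forall c : 'I_d -> k, \sum_(i < d) c i *: b i = 0 -> forall i, c i = 0.

(* 0 if W is not finite-dimensional *)
Definition subspace_dim (k : fieldType) (V : lmodType k) (W : set V) : nat :=
  xget 0%N [set d | has_dim W d].

(* A power series in z is identified with its sequence of coefficients. *)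
Definition hilbert_series (k : fieldType) (V : lmodType k) (G : nat -> set V)
  (W : set V) : nat -> nat :=
  fun i => subspace_dim (G i `&` W).

(* Right A-modules are left modules over the converse ring A^c, so that
   (a : A^c) *: x is x acted on by a from the right, and (A^c)^o is A as a
   right module over itself. *)

Record graded_right_module (k : fieldType) (A : algType k) (G : nat -> set A)
  (M : lmodType A^c) (H : nat -> set M) : Prop := GradedRightModule {
  graded_right_module_grading : is_grading H;
  graded_right_moduleM : forall i j (x : M) (a : A),
    H i x -> G j a -> H (i + j)%N ((a : A^c) *: x) }.

(* M has a basis e of homogeneous elements over A. *)
Definition graded_free (k : fieldType) (A : algType k) (G : nat -> set A)
  (M : lmodType A^c) (H : nat -> set M) : Prop :=
  graded_right_module G H /\
  exists (B : Type) (deg : B -> nat) (e : B -> M),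
    [/\ forall b, H (deg b) (e b),
        forall x, exists (N : nat) (b : 'I_N -> B) (a : 'I_N -> A),
          x = \sum_(i < N) (a i : A^c) *: e (b i)
      & forall (N : nat) (b : 'I_N -> B) (a : 'I_N -> A), injective b ->
          \sum_(i < N) (a i : A^c) *: e (b i) = 0 -> forall i, a i = 0].

(* Resolutions ... -> P_1 -> P_0 -> I -> 0 by graded free right modules, with
   all maps of degree 0; the augmentation P_0 -> I is written as a map to A
   with image I. *)
Record graded_free_resolution (k : fieldType) (A : algType k)
  (G : nat -> set A) (I : set A) : Type := GradedFreeResolution {
  res_mod : nat -> lmodType A^c;
  res_gr : forall n, nat -> set (res_mod n);
  res_diff : forall n, {linear res_mod n.+1 -> res_mod n};
  res_aug : {linear res_mod 0%N -> (A^c)^o};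
  res_free : forall n, graded_free G (@res_gr n);
  res_diff_gr : forall n j x, res_gr j x -> res_gr j (res_diff n x);
  res_aug_gr : forall j x, res_gr j x -> G j (res_aug x);
  res_range_aug : range res_aug = I;
  res_exact0 : [set x | res_aug x = 0] = range (res_diff 0%N);
  res_exactS : forall n, [set x | res_diff n x = 0] = range (res_diff n.+1) }.

Arguments res_gr {k A G I} g n j _.

(* M A_+, where A_+ is the ideal spanned by the homogeneous elements of
   positive degree; as k = A / A_+, one has (M tensor_A k) = M / M A_+. *)
Definition mul_Aplus (k : fieldType) (A : algType k) (G : nat -> set A)
  (M : lmodType A^c) : set M :=
  [set x | exists (N : nat) (y : 'I_N -> M) (a : 'I_N -> A),
     (forall i, exists2 j : nat, (0 < j)%N & G j (a i)) /\
     x = \sum_(i < N) (a i : A^c) *: y i].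

(* Preimages in P_n of the n-cycles and n-boundaries of the complex
   P tensor_A k = P / P A_+. *)
Definition tor_cycles (k : fieldType) (A : algType k) (G : nat -> set A)
  (I : set A) (P : graded_free_resolution G I) (n : nat) : set (res_mod P n) :=
  match n with
  | 0 => setT
  | m.+1 => [set x | mul_Aplus G (res_diff P m x)]
  end.

Definition tor_boundaries (k : fieldType) (A : algType k) (G : nat -> set A)
  (I : set A) (P : graded_free_resolution G I) (n : nat) : set (res_mod P n) :=
  [set x | exists (y : res_mod P n) (z : res_mod P n.+1),
     mul_Aplus G y /\ x = y + res_diff P n z].

Arguments tor_cycles {k A G I} P n _.
Arguments tor_boundaries {k A G I} P n _.

(* Tor_n^A(I, k)_j = 0.  The homology of P tensor_A k does not depend on the
   resolution P, so one may ask for some resolution. *)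
Definition tor_vanishes (k : fieldType) (A : algType k) (G : nat -> set A)
  (I : set A) (n j : nat) : Prop :=
  exists P : graded_free_resolution G I,
    res_gr P n j `&` tor_cycles P n `<=` tor_boundaries P n.

Definition generators_in_degrees_le (k : fieldType) (A : algType k)
  (G : nat -> set A) (D : nat) (I : set A) : Prop :=
  forall j : nat, (D < j)%N -> tor_vanishes G I 0 j.

Definition relations_in_degrees_le (k : fieldType) (A : algType k)
  (G : nat -> set A) (D : nat) (I : set A) : Prop :=
  forall j : nat, (D < j)%N -> tor_vanishes G I 1 j.

(* Main.v *)
Require Import Defs.
From mathcomp Require Import all_boot all_algebra.
From mathcomp Require Import boolp classical_sets functions cardinality.
From mathcomp Require Import monalg zify.

(* Fix the number of generators in each degree [<= D] to be the dimension of that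
   degree of [A]; the tuples of generators then form an affine space [X], and the
   degree [n] part of the ideal of [x] in [X] is the image of a matrix [M_n(x)]
   whose entries are polynomial in [x], so that its dimension [rank M_n(x)] is
   lower semicontinuous.

   If infinitely many Hilbert series occurred, there would be a closed [Z] in [X],
   minimal with that property; it is irreducible, and outside a proper closed
   subset the ranks in degrees [<= D] are the generic ones.  Let [x] in this open
   part of [Z] have its syzygies generated in degrees [<= D].  By constancy of the
   rank and Cramer's rule, the syzygies of degree [<= D] at [x] extend to
   polynomial families of syzygies over a neighborhood of [x] in [Z], hence so do
   all syzygies at [x].  Linear independence is an open condition, so no rank
   is larger near [x] than at [x], and every rank at [x] is generic: all such
   [x] give the same series, which contradicts the choice of [Z]. *)

Set Implicit Arguments.
Unset Strict Implicit.
Unset Printing Implicit Defensive.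

Import GRing.Theory.
Local Open Scope classical_set_scope.
Local Open Scope ring_scope.

(** * The Hilbert basis theorem *)

Inductive ideal_gen (R : comNzRingType) (S : set R) : set R :=
| ideal_gen0 : ideal_gen S 0
| ideal_gen_cons a s p : S s -> ideal_gen S p -> ideal_gen S (a * s + p).

Section IdealGen.
Variable R : comNzRingType.
Implicit Types S : set R.

Lemma ideal_genD S p q : ideal_gen S p -> ideal_gen S q -> ideal_gen S (p + q).
Proof.
elim=> [|a s p' Ss _ IH] Sq; first by rewrite add0r.
by rewrite -addrA; apply: ideal_gen_cons => //; apply: IH.
Qed.

Lemma ideal_genM S a p : ideal_gen S p -> ideal_gen S (a * p).
Proof.
elim=> [|b s q Ss _ IH]; first by rewrite mulr0; apply: ideal_gen0.
by rewrite mulrDr mulrA; apply: ideal_gen_cons.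
Qed.

Lemma ideal_genB S p q : ideal_gen S p -> ideal_gen S q -> ideal_gen S (p - q).
Proof. by move=> Sp Sq; rewrite -mulN1r; apply/ideal_genD/ideal_genM. Qed.

Lemma ideal_gen_mem S s : S s -> ideal_gen S s.
Proof.
by move=> Ss; rewrite -(mul1r s) -[1 * s]addr0; apply: ideal_gen_cons => //;
  apply: ideal_gen0.
Qed.

Lemma ideal_gen_sub S S' : S `<=` ideal_gen S' -> ideal_gen S `<=` ideal_gen S'.
Proof.
move=> SS' p; elim=> [|a s q Ss _ IH]; first exact: ideal_gen0.
by apply: ideal_genD => //; apply/ideal_genM/SS'.
Qed.

End IdealGen.

(** Sequence form of the ascending chain condition: it yields at once that a descending chain of
    zero sets, each cut out by one more equation, stalls. *)
Definition noetherian (R : comNzRingType) :=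
  forall f : nat -> R, exists n, ideal_gen [set f i | i in [set i | (i < n)%N]] (f n).

Lemma noetherian_field (k : fieldType) : noetherian k.
Proof.
move=> f; have [f0|f0] := eqVneq (f 0%N) 0.
  by exists 0%N; rewrite f0; apply: ideal_gen0.
exists 1%N; rewrite -[f 1%N](divfK f0).
by apply: ideal_genM; apply: ideal_gen_mem; exists 0%N.
Qed.

Section HilbertBasis.
Variable R : comNzRingType.
Hypothesis noethR : noetherian R.

(** Hilbert's argument by contradiction. From a sequence [f] whose terms all escape the ideal of
    their predecessors, build [g] by taking for [g n] an element of least size in the ideal [J] of
    [f] outside the ideal of the earlier [g i]. Some leading coefficient is a combination of the
    earlier ones, and cancelling it gives a smaller candidate for [g n]. *)
Lemma noetherian_poly : noetherian {poly R}.
Proof.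
move=> f; apply: contrapT => /forallNP fN.
pose J := ideal_gen (range f).
(* A finite subset of [J] involves only finitely many terms of [f], so it cannot generate the next
   term [f M]. *)
have J_bound (s : seq {poly R}) : [set` s] `<=` J ->
    exists M, [set` s] `<=` ideal_gen [set f i | i in [set i | (i < M)%N]].
  have mono M M' : (M <= M')%N -> ideal_gen [set f i | i in [set i | (i < M)%N]] `<=`
    ideal_gen [set f i | i in [set i | (i < M')%N]].
    move=> leM; apply: ideal_gen_sub => _ [i /= ltiM <-].
    by apply: ideal_gen_mem; exists i => //=; apply: leq_trans ltiM leM.
  have J_bound1 p : J p -> exists M, ideal_gen [set f i | i in [set i | (i < M)%N]] p.
    elim=> [|a _ q [i _ <-] _ [M IH]]; first by exists 0%N; apply: ideal_gen0.
    exists (maxn i.+1 M); apply: ideal_genD.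
      by apply/ideal_genM/ideal_gen_mem; exists i => //=; rewrite leq_maxl.
    by apply: mono IH; apply: leq_maxr.
  elim: s => [|p s IH] sJ; first by exists 0%N.
  have [|M1 HM1] := J_bound1 p; first by apply: sJ; rewrite /= inE eqxx.
  have [|M2 HM2] := IH; first by move=> q qs; apply: sJ; rewrite /= inE qs orbT.
  exists (maxn M1 M2) => q /=; rewrite inE => /orP[/eqP->|qs].
    by apply: mono HM1; apply: leq_maxl.
  by apply: mono (HM2 _ qs); apply: leq_maxr.
have choose (s : seq {poly R}) : exists p : {poly R}, [set` s] `<=` J ->
    [/\ J p, ~ ideal_gen [set` s] p &
     forall q, J q -> ~ ideal_gen [set` s] q -> (size p <= size q)%N].
  have [sJ|] := pselect ([set` s] `<=` J); last by exists 0.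
  have [M sM] := J_bound s sJ.
  have ex : exists n, `[< exists p : {poly R}, [/\ J p, ~ ideal_gen [set` s] p
      & size p = n] >].
    exists (size (f M)); apply/asboolP; exists (f M); split=> //.
      by apply: ideal_gen_mem; exists M.
    by move=> /(ideal_gen_sub sM); apply: fN.
  case: (ex_minnP ex) => n /asboolP[p [Jp Np sp]] minn.
  exists p => _; split=> // q Jq Nq; rewrite sp; apply: minn.
  by apply/asboolP; exists q.
have [phi phiP] := choice choose.
pose fix L n := if n is n'.+1 then rcons (L n') (phi (L n')) else [::].
pose g n := phi (L n).
have LS n : L n.+1 = rcons (L n) (g n) by [].
have LP n p : p \in L n <-> exists2 i, (i < n)%N & g i = p.
  elim: n p => [|n IH] p; first by split=> // -[].
  rewrite LS mem_rcons inE; split.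
    case/orP=> [/eqP->|H]; first by exists n.
    have [i ltin <-] := proj1 (IH _) H.
    by exists i => //; apply: ltnW.
  case=> i; rewrite ltnS leq_eqVlt => /orP[/eqP->|ltin] <-; first by rewrite eqxx.
  by apply/orP; right; apply/IH; exists i.
have LJ n : [set` L n] `<=` J.
  elim: n => [|n IH] p //; rewrite LS /= mem_rcons inE => /orP[/eqP->|/IH//].
  by have [] := phiP _ IH.
have gJ n : J (g n) by have [] := phiP _ (LJ n).
have gN n : ~ ideal_gen [set` L n] (g n) by have [] := phiP _ (LJ n).
have gmin n q : J q -> ~ ideal_gen [set` L n] q -> (size (g n) <= size q)%N.
  by have [_ _] := phiP _ (LJ n); apply.
have gmono i n : (i <= n)%N -> (size (g i) <= size (g n))%N.
  move=> lein; apply: gmin => // H; apply: (gN n).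
  apply: ideal_gen_sub H => p /LP[j ltji <-]; apply: ideal_gen_mem => /=.
  by apply/LP; exists j => //; apply: leq_trans lein.
have [n] := noethR (fun i => lead_coef (g i)).
(* Multiplying [g i] by a power of the variable raises it to the size of [g n], so every combination
   of the earlier leading coefficients occurs in the top position of [g n] for some element of the
   ideal. *)
have step y : ideal_gen [set lead_coef (g i) | i in [set i | (i < n)%N]] y ->
   exists p, [/\ ideal_gen [set` L n] p, (size p <= size (g n))%N &
     p`_(size (g n)).-1 = y].
  elim=> [|a _ q [i /= ltin <-] _ [p [pL sp <-]]].
    by exists 0; rewrite coef0 size_poly0; split=> //; apply: ideal_gen0.
  have gi0 : g i != 0.
    by apply/eqP => gi0; apply: (gN i); rewrite gi0; apply: ideal_gen0.
  have szi : (0 < size (g i))%N by rewrite size_poly_gt0.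
  have szin := gmono i n (ltnW ltin).
  exists (a *: 'X^(size (g n) - size (g i)) * g i + p); split.
  - by apply: ideal_gen_cons => //=; apply/LP; exists i.
  - rewrite (leq_trans (size_polyD _ _)) // geq_max sp andbT.
    rewrite -scalerAl (leq_trans (size_scale_leq _ _)) // mulrC size_mulXn //.
    by rewrite subnK.
  - rewrite coefD -scalerAl coefZ coefXnM.
    have -> : ((size (g n)).-1 < size (g n) - size (g i))%N = false.
      by apply/negbTE; rewrite -leqNgt; lia.
    congr (_ * _ + _); rewrite lead_coefE; congr (_`_ _).
    by move: szi szin; move: (size (g i)) (size (g n)) => a' b'; lia.
move=> /step[p [pL sp lp]].
have gn0 : g n != 0.
  by apply/eqP => gn0; apply: (gN n); rewrite gn0; apply: ideal_gen0.
have Np : ~ ideal_gen [set` L n] (g n - p).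
  by move=> H; apply: (gN n); rewrite -(subrK p (g n)); apply: ideal_genD.
have : (size (g n) <= size (g n - p)%R)%N.
  by apply: gmin => //; apply: (ideal_genB (gJ n)); apply: (ideal_gen_sub (LJ n)).
apply/negP; rewrite -ltnNge.
have sn : (0 < size (g n))%N by rewrite size_poly_gt0.
rewrite -(prednK sn) ltnS; apply/leq_sizeP => j; rewrite leq_eqVlt.
case/orP=> [/eqP<-|ltj]; first by rewrite coefB lp lead_coefE subrr.
have sj : (size (g n) <= j)%N by rewrite -(prednK sn).
by rewrite coefB !nth_default ?subrr //; apply: leq_trans sj.
Qed.

End HilbertBasis.

(** * Polynomial functions on affine space *)

Inductive polyfun (k : fieldType) (N : nat) : set ((nat -> k) -> k) :=
| polyfun_const a : polyfun N (fun=> a)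
| polyfun_coord q : (q < N)%N -> polyfun N (fun x => x q)
| polyfunD f g : polyfun N f -> polyfun N g -> polyfun N (fun x => f x + g x)
| polyfunM f g : polyfun N f -> polyfun N g -> polyfun N (fun x => f x * g x).

(** The ring is that of polynomials in [N] variables, adjoined one at a time, and [ev x] is
    evaluation at [x]. Points are infinite sequences of which only the first [N] coordinates are
    read, so the induction keeps the type of points. *)
Lemma polyfun_ring (k : fieldType) (N : nat) :
  exists (R : comNzRingType) (ev : (nat -> k) -> {rmorphism R -> k}),
    [/\ noetherian R, forall a, exists r, forall x, ev x r = a
      & forall q, (q < N)%N -> exists r, forall x, ev x r = x q].
Proof.
elim: N => [|N [R [ev [nR evC evX]]]].
  exists k, (fun=> idfun); split=> //; first exact: noetherian_field.
  by move=> a; exists a.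
exists {poly R}, (fun x => [the {rmorphism _ -> _} of
  horner_eval (x N) \o map_poly (ev x)]); split.
- exact: noetherian_poly.
- move=> a; have [r rE] := evC a; exists r%:P => x.
  by rewrite /= map_polyC horner_evalE hornerC; apply: rE.
- move=> q; rewrite ltnS leq_eqVlt => /orP[/eqP->|/evX[r rE]].
    by exists 'X => x; rewrite /= map_polyX horner_evalE hornerX.
  by exists r%:P => x; rewrite /= map_polyC horner_evalE hornerC; apply: rE.
Qed.

(** Lift the functions to the Noetherian ring: an element of the ideal of the earlier ones vanishes
    at their common zeros. *)
Lemma polyfun_noetherian (k : fieldType) (N : nat) (f : nat -> (nat -> k) -> k) :
  (forall n, polyfun N (f n)) ->
  exists n, forall x, (forall i, (i < n)%N -> f i x = 0) -> f n x = 0.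
Proof.
move=> pf; have [R [ev [nR evC evX]]] := polyfun_ring k N.
have lift n : exists r, forall x, ev x r = f n x.
  elim: {n}(f n) / (pf n) => [a|q /evX//|g h _ [r rE] _ [s sE]|g h _ [r rE] _ [s sE]].
  - exact: evC.
  - by exists (r + s) => x; rewrite rmorphD rE sE.
  - by exists (r * s) => x; rewrite rmorphM rE sE.
have [r rE] := choice lift.
have [n rn] := nR r; exists n => x fx0; rewrite -rE.
elim: rn => [|a _ p [i /= ltin <-] _ IH]; first by rewrite rmorph0.
by rewrite rmorphD rmorphM rE fx0 // mulr0 IH addr0.
Qed.

(** * Ranks and kernels of polynomial matrices *)

Section PolyMatrix.
Variables (k : fieldType) (N : nat).
Local Notation X := (nat -> k).
Local Notation polyfun := (polyfun (k := k) N).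

Lemma polyfun_sum (I : Type) (r : seq I) (P : pred I) (f : I -> X -> k) :
  (forall i, polyfun (f i)) -> polyfun (fun x => \sum_(i <- r | P i) f i x).
Proof.
move=> pf; elim: r => [|i r IH].
  rewrite (_ : (fun _ => _) = (fun=> 0)); first exact: polyfun_const.
  by apply/funext => x; rewrite big_nil.
under eq_fun do rewrite big_cons.
by case: (P i) => //; apply: polyfunD.
Qed.

Lemma polyfun_prod (I : Type) (r : seq I) (P : pred I) (f : I -> X -> k) :
  (forall i, polyfun (f i)) -> polyfun (fun x => \prod_(i <- r | P i) f i x).
Proof.
move=> pf; elim: r => [|i r IH].
  rewrite (_ : (fun _ => _) = (fun=> 1)); first exact: polyfun_const.
  by apply/funext => x; rewrite big_nil.
under eq_fun do rewrite big_cons.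
by case: (P i) => //; apply: polyfunM.
Qed.

Definition polymx m n (M : X -> 'M[k]_(m, n)) :=
  forall i j, polyfun (fun x => M x i j).

Lemma polymx_const m n (M : 'M[k]_(m, n)) : polymx (fun=> M).
Proof. by move=> i j; apply: polyfun_const. Qed.

Lemma polymxM m n p (M : X -> 'M[k]_(m, n)) (M' : X -> 'M[k]_(n, p)) :
  polymx M -> polymx M' -> polymx (fun x => M x *m M' x).
Proof.
move=> pM pM' i j; under eq_fun do rewrite mxE.
by apply: polyfun_sum => l; apply: polyfunM.
Qed.

Lemma polymxB m n (M M' : X -> 'M[k]_(m, n)) :
  polymx M -> polymx M' -> polymx (fun x => M x - M' x).
Proof.
move=> pM pM' i j; under eq_fun do rewrite !mxE -mulN1r.
by apply: polyfunD => //; apply: polyfunM => //; apply: polyfun_const.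
Qed.

Lemma polymxZ m n f (M : X -> 'M[k]_(m, n)) :
  polyfun f -> polymx M -> polymx (fun x => f x *: M x).
Proof. by move=> pf pM i j; under eq_fun do rewrite mxE; apply: polyfunM. Qed.

Lemma polyfun_det n (M : X -> 'M[k]_n) :
  polymx M -> polyfun (fun x => \det (M x)).
Proof.
move=> pM; apply: polyfun_sum => s; apply: polyfunM; first exact: polyfun_const.
exact: polyfun_prod.
Qed.

Lemma polymx_adj n (M : X -> 'M[k]_n) : polymx M -> polymx (fun x => \adj (M x)).
Proof.
move=> pM i j; under eq_fun do rewrite mxE.
apply: polyfunM; first exact: polyfun_const.
by apply: polyfun_det => s t; under eq_fun do rewrite !mxE; apply: pM.
Qed.

(** Inverting the outer factors of the Gaussian decomposition of [M], and truncating to as many rows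
    and columns as the rank, leaves an identity block. *)
Lemma mxrank_factor m n (M : 'M[k]_(m, n)) :
  exists (L : 'M_(\rank M, m)) (R : 'M_(n, \rank M)), L *m M *m R = 1%:M.
Proof.
exists (pid_mx (\rank M) *m invmx (col_ebase M)).
exists (invmx (row_ebase M) *m pid_mx (\rank M)).
rewrite -[X in _ *m X *m (_ *m _)]mulmx_ebase !mulmxA mulmxKV ?col_ebase_unit //.
rewrite mulmxK ?row_ebase_unit // !mul_pid_mx !minnn.
by rewrite (minn_idPr (rank_leq_row M)) minnn (minn_idPr (rank_leq_col M)) pid_mx_1.
Qed.

Lemma mxrank_det_neq0 m n r (L : 'M_(r, m)) (M : 'M[k]_(m, n)) (R : 'M_(n, r)) :
  \det (L *m M *m R) != 0 -> (r <= \rank M)%N.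
Proof.
rewrite -unitfE -unitmxE => /mxrank_unit <-.
by rewrite (leq_trans (mxrankM_maxl _ _)) // mxrankM_maxr.
Qed.

(** Keep the [L] and [R] found at [x]: the determinant of [L M(z) R] is 1 at [x], and where it is
    nonzero the rank is at least that of [M x]. *)
Lemma mxrank_semicontinuous m n (M : X -> 'M[k]_(m, n)) x : polymx M ->
  exists g, [/\ polyfun g, g x != 0 &
    forall z, g z != 0 -> (\rank (M x) <= \rank (M z))%N].
Proof.
move=> pM; have [L [R LMR]] := mxrank_factor (M x).
exists (fun z => \det (L *m M z *m R)); split.
- apply: polyfun_det; apply: polymxM; last exact: polymx_const.
  by apply: polymxM => //; apply: polymx_const.
- by rewrite LMR det1 oner_neq0.
- by move=> z; apply: mxrank_det_neq0.
Qed.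

(* Cramer's rule: if [L M(x) R = 1] and [d = L M R], the vector
   [det(d) c - c M R adj(d) L] equals [c] at [x], and it kills [M R], hence [M]
   wherever the columns of [M R] still span those of [M]. *)
Lemma left_kernel_lift m n (M : X -> 'M[k]_(m, n)) x (c : 'rV_m) : polymx M ->
  c *m M x = 0 ->
  exists g (C : X -> 'rV[k]_m), [/\ polyfun g, polymx C, g x != 0, C x = c &
    forall z, g z != 0 -> (\rank (M z) <= \rank (M x))%N -> C z *m M z = 0].
Proof.
move=> pM cM; have [L [R LMR]] := mxrank_factor (M x).
pose d z := L *m M z *m R.
have pd : polymx d.
  apply: polymxM; last exact: polymx_const.
  by apply: polymxM => //; apply: polymx_const.
exists (fun z => \det (d z)).
exists (fun z => \det (d z) *: c - c *m M z *m R *m \adj (d z) *m L); split.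
- exact: polyfun_det.
- apply: polymxB.
    by apply: polymxZ; [apply: polyfun_det|apply: polymx_const].
  apply: polymxM; last exact: polymx_const.
  apply: polymxM; last exact: polymx_adj.
  apply: polymxM; last exact: polymx_const.
  by apply: polymxM => //; apply: polymx_const.
- by rewrite /d LMR det1 oner_neq0.
- by rewrite cM !mul0mx subr0 /d LMR det1 scale1r.
move=> z dz rM.
have rMR : (\rank (M x) <= \rank (M z *m R))%N.
  by apply: (@mxrank_det_neq0 _ _ _ L _ 1%:M); rewrite mulmx1 mulmxA.
have /submxP[T MT] : ((M z)^T <= (M z *m R)^T)%MS.
  have sub : ((M z *m R)^T <= (M z)^T)%MS by rewrite trmx_mul submxMl.
  rewrite -(geq_leqif (mxrank_leqif_sup sub)) !mxrank_tr.
  exact: leq_trans rMR.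
have {MT} ME : M z = M z *m R *m T^T.
  by apply: trmx_inj; rewrite MT [RHS]trmx_mul trmxK.
rewrite [X in _ *m X]ME mulmxA mulmxBl -scalemxAl -(mulmxA _ L) [L *m _]mulmxA -/(d z).
by rewrite -(mulmxA _ (\adj _)) mul_adj_mx mul_mx_scalar mulmxA subrr mul0mx.
Qed.

End PolyMatrix.

(** * Graded right modules *)

Lemma bigsum_widen (V : zmodType) (d : nat -> V) M M' :
  (forall i, (M <= i)%N -> d i = 0) -> (M <= M')%N ->
  \sum_(i < M) d i = \sum_(i < M') d i.
Proof.
move=> d0 le; rewrite -!(big_mkord xpredT) (big_cat_nat (leq0n M) le) /=.
by rewrite [X in _ + X]big_nat_cond [X in _ + X]big1 ?addr0 // => j /andP[/andP[/d0]].
Qed.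

(** The vanishing tail makes the sequence [c] unique; in [grading_sum] the terms from [N] on are
    arbitrary. *)
Definition homogeneous_parts (V : zmodType) (H : nat -> set V) (x : V)
    (c : nat -> V) :=
  (forall i, H i (c i)) /\
  exists N, (forall i, (N <= i)%N -> c i = 0) /\ x = \sum_(i < N) c i.

Definition hpart (V : zmodType) (H : nat -> set V) (n : nat) (x : V) : V :=
  xget (fun=> 0) [set c | homogeneous_parts H x c] n.

Section Grading.
Variables (V : zmodType) (H : nat -> set V).
Hypothesis hH : is_grading H.

Lemma gradingN i x : H i x -> H i (- x).
Proof.
by move=> Hx; rewrite -sub0r; apply: (gradingB hH) => //; apply: (grading0 hH).
Qed.

Lemma gradingD i x y : H i x -> H i y -> H i (x + y).
Proof.
by move=> Hx Hy; rewrite -[y]opprK; apply: (gradingB hH) => //; apply: gradingN.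
Qed.

Lemma grading_bigsum i (I : Type) (r : seq I) (P : pred I) (F : I -> V) :
  (forall j, P j -> H i (F j)) -> H i (\sum_(j <- r | P j) F j).
Proof.
by move=> HF; apply: big_ind => //; [apply: (grading0 hH)|apply: gradingD].
Qed.

Lemma homogeneous_parts_uniq x c c' :
  homogeneous_parts H x c -> homogeneous_parts H x c' -> c = c'.
Proof.
move=> [Hc [N [c0 xE]]] [Hc' [N' [c'0 xE']]]; apply/funext => i.
pose M := (i + (N + N')).+1%N.
apply/eqP; rewrite -subr_eq0; apply/eqP.
apply: (grading_direct hH (N := M) (c := fun i => c i - c' i)); last by rewrite /M; lia.
  by move=> j; apply: (gradingB hH).
rewrite sumrB -(bigsum_widen c0) -?(bigsum_widen c'0) -?xE -?xE' ?subrr // /M; lia.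
Qed.

Lemma hpart_spec x : homogeneous_parts H x (hpart H ^~ x).
Proof.
have [N [c [Hc xE]]] := grading_sum hH x.
have := @xgetPex _ (fun=> 0) [set c | homogeneous_parts H x c]; apply.
exists (fun i => if (i < N)%N then c i else 0); split.
  by move=> i; case: ifP => // _; apply: (grading0 hH).
exists N; split; first by move=> i; rewrite leqNgt => /negbTE ->.
by rewrite xE; apply: eq_bigr => i _; rewrite ltn_ord.
Qed.

Lemma hpartE x c n : homogeneous_parts H x c -> hpart H n x = c n.
Proof. by move/(homogeneous_parts_uniq (hpart_spec x)) => <-. Qed.

Lemma hpartP n x : H n (hpart H n x).
Proof. by case: (hpart_spec x). Qed.

Lemma hpart_sum x : exists N, x = \sum_(i < N) hpart H i x.
Proof. by case: (hpart_spec x) => _ [N [_ xE]]; exists N. Qed.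

Lemma hpart_homog n m x : H n x -> hpart H m x = if m == n then x else 0.
Proof.
move=> Hx; apply: (hpartE (c := fun m => if m == n then x else 0)); split.
  by move=> i; case: eqP => [->//|_]; apply: (grading0 hH).
exists n.+1; split; first by move=> i; case: eqP => // ->; rewrite ltnn.
by rewrite big_ord_recr /= eqxx big1 ?add0r // => i _; rewrite ltn_eqF.
Qed.

Lemma hpart_id n x : H n x -> hpart H n x = x.
Proof. by move/hpart_homog => ->; rewrite eqxx. Qed.

Lemma hpart0 n : hpart H n 0 = 0.
Proof. by rewrite (@hpart_homog n) ?if_same //; apply: (grading0 hH). Qed.

Lemma hpartB n x y : hpart H n (x - y) = hpart H n x - hpart H n y.
Proof.
have [Hx [N [x0 xE]]] := hpart_spec x; have [Hy [N' [y0 yE]]] := hpart_spec y.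
apply: (hpartE (c := fun n => hpart H n x - hpart H n y)); split.
  by move=> i; apply: (gradingB hH).
exists (N + N')%N; split.
  by move=> i le; rewrite x0 ?y0 ?subr0 //; lia.
rewrite sumrB.
have <- := bigsum_widen x0 (leq_addr N' N).
have <- := bigsum_widen y0 (leq_addl N N').
by rewrite -xE -yE.
Qed.

Lemma hpartD n x y : hpart H n (x + y) = hpart H n x + hpart H n y.
Proof. by rewrite -{1}[y]opprK -[- y]sub0r !hpartB hpart0 sub0r opprK. Qed.

Lemma hpart_bigsum n (I : Type) (r : seq I) (P : pred I) (F : I -> V) :
  hpart H n (\sum_(j <- r | P j) F j) = \sum_(j <- r | P j) hpart H n (F j).
Proof.
by apply: (big_morph (hpart H n)); [move=> x y; apply: hpartD|apply: hpart0].
Qed.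

End Grading.

Lemma hpart_morph (V W : zmodType) (H : nat -> set V) (H' : nat -> set W)
    (f : V -> W) n x :
  is_grading H -> is_grading H' -> {morph f : x y / x + y} ->
  (forall i x, H i x -> H' i (f x)) -> hpart H' n (f x) = f (hpart H n x).
Proof.
move=> hH hH' fD fH; have f0 : f 0 = 0.
  by apply: (addrI (f 0)); rewrite -fD !addr0.
apply: (hpartE hH' (c := fun n => f (hpart H n x))).
have [Hx [N [x0 xE]]] := hpart_spec hH x.
split; first by move=> i; apply: fH.
exists N; split; first by move=> i /x0 ->.
by rewrite {1}xE (big_morph f fD f0).
Qed.

(* [ra v a] is the action of [a] on [v] from the right.  Abstracting it lets the
   same argument run over [A], its free modules and the modules over [A^c]. *)
Record graded_right_action (k : fieldType) (A : algType k) (G : nat -> set A)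
    (V : zmodType) (H : nat -> set V) (ra : V -> A -> V) : Prop :=
  GradedRightAction {
  raction_grading : is_grading H;
  ractionDl : forall x y a, ra (x + y) a = ra x a + ra y a;
  raction1 : forall x, ra x 1 = x;
  ractionA : forall x a b, ra (ra x a) b = ra x (a * b);
  raction_graded : forall i j x a, H i x -> G j a -> H (i + j)%N (ra x a) }.

Section RightAction.
Variables (k : fieldType) (A : algType k) (G : nat -> set A).
Hypothesis hG : connected_graded G.
Variables (V : zmodType) (H : nat -> set V) (ra : V -> A -> V).
Hypothesis hra : graded_right_action G H ra.

Let hH := raction_grading hra.

Lemma raction0l a : ra 0 a = 0.
Proof. by apply: (addrI (ra 0 a)); rewrite -(ractionDl hra) !addr0. Qed.

Lemma raction_suml (I : Type) (r : seq I) (P : pred I) (F : I -> V) a :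
  ra (\sum_(j <- r | P j) F j) a = \sum_(j <- r | P j) ra (F j) a.
Proof.
by apply: (big_morph (ra^~ a)); [move=> x y; apply: (ractionDl hra)|apply: raction0l].
Qed.

Lemma hpart_raction n e x a : G e a ->
  hpart H n (ra x a) = if (e <= n)%N then ra (hpart H (n - e)%N x) a else 0.
Proof.
move=> Ga; have [Hx [N [x0 xE]]] := hpart_spec hH x.
rewrite {1}xE raction_suml (hpart_bigsum hH).
under eq_bigr => i _ do
  rewrite (hpart_homog hH n (raction_graded hra (hpartP hH i x) Ga)).
case: leqP => [len|ltn]; last first.
  by rewrite big1 // => i _; case: eqP => // nE; lia.
have [ltN|leN] := ltnP (n - e) N; last first.
  rewrite x0 // raction0l big1 // => i _; case: eqP => // nE.
  by have := ltn_ord i; lia.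
rewrite (bigD1 (Ordinal ltN)) //= subnK // eqxx big1 ?addr0 // => i ni.
case: eqP => // nE; case/eqP: ni; apply: val_inj => /=; lia.
Qed.

(** * Generation in bounded degrees and the graded Nakayama lemma *)

Inductive generated_le (D : nat) (N : set V) : nat -> set V :=
| generated_le0 n : generated_le D N n 0
| generated_le_cons n j s a f : (j <= n)%N -> (j <= D)%N -> N s -> H j s ->
    G (n - j)%N a -> generated_le D N n f -> generated_le D N n (ra s a + f).

Lemma generated_leD D N n x y :
  generated_le D N n x -> generated_le D N n y -> generated_le D N n (x + y).
Proof.
move=> Hx Hy; elim: Hx Hy => {n x} [|n j s a f jn jD Ns Hs Ga _ IH] *.
  by rewrite add0r.
by rewrite -addrA; apply: (generated_le_cons jn); last exact: IH.
Qed.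

Lemma generated_le_raction D N n e x a :
  generated_le D N n x -> G e a -> generated_le D N (n + e) (ra x a).
Proof.
move=> Hx Ga; elim: Hx => {n x} [n|n j s b f jn jD Ns Hs Gb _ IH].
  by rewrite raction0l; apply: generated_le0.
rewrite (ractionDl hra) (ractionA hra).
apply: (generated_le_cons (j := j)) => //; first exact: leq_trans (leq_addr _ _).
by rewrite -addnBAC //; apply: (connected_gradedM hG).
Qed.

(* [N A_+], where [A_+] is the ideal of elements of positive degree. *)
Inductive Aplus_span (N : set V) : set V :=
| Aplus_span0 : Aplus_span N 0
| Aplus_span_cons e s a f : (0 < e)%N -> N s -> G e a -> Aplus_span N f ->
    Aplus_span N (ra s a + f).

Lemma Aplus_spanD N x y :
  Aplus_span N x -> Aplus_span N y -> Aplus_span N (x + y).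
Proof.
move=> Hx Hy; elim: Hx => {x} [|e s a f e0 Ns Ga _ IH]; first by rewrite add0r.
by rewrite -addrA; apply: Aplus_span_cons Ga IH.
Qed.

Lemma Aplus_span_bigsum N (I : Type) (r : seq I) (y : I -> V) (a : I -> A) :
  (forall i, N (y i)) -> (forall i, exists2 e, (0 < e)%N & G e (a i)) ->
  Aplus_span N (\sum_(i <- r) ra (y i) (a i)).
Proof.
move=> Ny Ga; elim: r => [|i r IH]; first by rewrite big_nil; apply: Aplus_span0.
by rewrite big_cons; have [e e0 Ge] := Ga i; apply: Aplus_span_cons Ge IH.
Qed.

(** Strong induction on the degree. For [n > D], write [x] as a sum of terms [ra s a] with [a] of
    degree [e > 0] and take components of degree [n]: each [s] is replaced by its component of
    degree [n - e], which lies in [N] and is generated by induction. *)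
Lemma graded_nakayama D (N : set V) :
  (forall n x, N x -> N (hpart H n x)) ->
  (forall j x, (D < j)%N -> N x -> H j x -> Aplus_span N x) ->
  forall n x, N x -> H n x -> generated_le D N n x.
Proof.
move=> Nh Ndec n; elim/ltn_ind: n => n IH x Nx Hx.
have [leD|ltD] := leqP n D.
  rewrite -[x](raction1 hra) -[ra x 1]addr0.
  apply: (generated_le_cons (j := n)) => //; last exact: generated_le0.
  by rewrite subnn (connected_graded_deg0 hG); exists 1; rewrite ?scale1r.
rewrite -(hpart_id hH Hx).
elim: (Ndec _ _ ltD Nx Hx) => [|e s a f e0 Ns Ga _ IHf].
  by rewrite (hpart0 hH); apply: generated_le0.
rewrite (hpartD hH); apply: generated_leD => //; rewrite (hpart_raction _ _ Ga).
case: leqP => len; last exact: generated_le0.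
rewrite -[X in generated_le _ _ X](subnK len).
apply: generated_le_raction => //; apply: IH.
- by rewrite ltn_subrL e0 (leq_ltn_trans (leq0n D)).
- exact: Nh.
- exact: hpartP.
Qed.

End RightAction.

(** * Finite-dimensional subspaces *)

Definition lin_span (k : fieldType) (V : lmodType k) (T : finType) (b : T -> V)
  : set V := range (fun c : T -> k => \sum_t c t *: b t).

Definition findim (k : fieldType) (V : lmodType k) (W : set V) : Prop :=
  exists (m : nat) (b : 'I_m -> V), W = lin_span b.

Definition subspace (k : fieldType) (V : lmodType k) (W : set V) : Prop :=
  [/\ W 0, forall x y, W x -> W y -> W (x + y) & forall a x, W x -> W (a *: x)].

(** Take [B] with rows in [P] and of maximal rank. Adding a vector of [P] to its row space cannot
    raise the rank, so the row space already contains it. *)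
Lemma subspace_rowspace (k : fieldType) (m : nat) (P : set 'rV[k]_m) :
  subspace P -> exists B : 'M_m, forall c, P c <-> (c <= B)%MS.
Proof.
move=> [P0 PD PZ].
have Pmul (B : 'M_m) c : (forall i, P (row i B)) -> (c <= B)%MS -> P c.
  move=> PB /submxP[D ->]; rewrite mulmx_sum_row.
  by apply: big_ind => // i _; apply: PZ.
pose Q r := `[< exists B : 'M[k]_m, (forall i, P (row i B)) /\ \rank B = r >].
have exQ : exists r, Q r.
  exists 0%N; apply/asboolP; exists 0; split; last by rewrite mxrank0.
  by move=> i; rewrite row0.
have bQ r : Q r -> (r <= m)%N by case/asboolP => B [_ <-]; apply: rank_leq_row.
case: (ex_maxnP exQ bQ) => r /asboolP[B [PB rB]] maxr.
exists B => c; split; last exact: Pmul.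
move=> Pc; have sub : (B <= B + c)%MS by apply: addsmxSl.
apply: (submx_trans (addsmxSr B c)).
rewrite -(geq_leqif (mxrank_leqif_sup sub)) rB; apply: maxr; apply/asboolP.
exists (B + c)%MS; split=> // i.
have /sub_addsmxP[[u v] /= ->] : (row i (B + c)%MS <= B + c)%MS by apply: row_sub.
apply: PD; first by apply: (Pmul B) => //; apply: submxMl.
by rewrite [v]mx11_scalar mul_scalar_mx; apply: PZ.
Qed.

Section FinDim.
Variables (k : fieldType) (V : lmodType k).
Implicit Types W : set V.

Lemma lin_span_subspace (T : finType) (b : T -> V) : subspace (lin_span b).
Proof.
split.
- by exists (fun=> 0) => //; rewrite big1 // => t _; rewrite scale0r.
- move=> _ _ [c _ <-] [d _ <-]; exists (fun t => c t + d t) => //.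
  by rewrite -big_split; apply: eq_bigr => t _; rewrite scalerDl.
- move=> a _ [c _ <-]; exists (fun t => a * c t) => //.
  by rewrite scaler_sumr; apply: eq_bigr => t _; rewrite scalerA.
Qed.

Lemma lin_span_mem (T : finType) (b : T -> V) t : lin_span b (b t).
Proof.
exists (fun i => (i == t)%:R) => //.
rewrite (bigD1 t) //= eqxx scale1r big1 ?addr0 // => i /negbTE ->.
by rewrite scale0r.
Qed.

Lemma findim_lin_span (T : finType) (b : T -> V) : findim (lin_span b).
Proof.
exists #|T|, (b \o enum_val); apply/seteqP; split=> _ [c _ <-].
  exists (c \o enum_val) => //=.
  by rewrite -(big_enum_val (fun t => c t *: b t)); apply: eq_bigl => t; rewrite inE.
exists (c \o enum_rank) => //.
rewrite [RHS](eq_bigr (fun i => c (enum_rank (enum_val i)) *: b (enum_val i))).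
  by rewrite -(big_enum_val (fun t => c (enum_rank t) *: b t)).
by move=> i _; rewrite enum_valK.
Qed.

(** A spanning family of least size is free: a relation with a nonzero coefficient [c j] expresses
    [b j] through the others and lets it be dropped. *)
Lemma findim_has_dim W : findim W -> exists d, has_dim W d.
Proof.
move=> fW; pose Q m := `[< exists b : 'I_m -> V, W = lin_span b >].
have exQ : exists m, Q m by have [m [b WE]] := fW; exists m; apply/asboolP; exists b.
case: (ex_minnP exQ) => d /asboolP[b WE] mind; exists d, b; split=> // c c0 j.
apply/eqP; apply: contraT => cj; suff /mind : Q d.-1.
  by have := ltn_ord j; lia.
case: d => [|d] in b WE mind c c0 j cj *; first by case: (j).
apply/asboolP; exists (b \o lift j); rewrite WE.
have bj : b j = \sum_i (- (c j)^-1 * c (lift j i)) *: b (lift j i).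
  move: c0; rewrite (bigD1_ord j) //= => /eqP; rewrite addr_eq0 => /eqP.
  move/(congr1 ( *:%R (c j)^-1)); rewrite scalerA mulVf // scale1r => ->.
  rewrite scalerN scaler_sumr -sumrN.
  by apply: eq_bigr => i _; rewrite scalerA mulNr scaleNr.
apply/seteqP; split=> _ [a _ <-].
  rewrite (bigD1_ord j) //= bj; have [_ LD LZ] := lin_span_subspace (b \o lift j).
  by apply: LD; [apply: LZ; eexists; last by []|exists (a \o lift j)].
exists (fun i => if unlift j i is Some i' then a i' else 0) => //.
rewrite (bigD1_ord j) //= unlift_none scale0r add0r.
by apply: eq_bigr => i _; rewrite liftK.
Qed.

(** The matrix expressing a free family in a spanning one has independent rows, so it has at most as
    many rows as columns. *)
Lemma has_dim_inj W d d' : has_dim W d -> has_dim W d' -> d = d'.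
Proof.
move: d d'; suff H d d' : has_dim W d -> has_dim W d' -> (d' <= d)%N.
  by move=> d d' h h'; apply/eqP; rewrite eqn_leq !H.
move=> [b [WE _]] [b' [WE' fb']].
have T_ex (j : 'I_d') : exists c : 'I_d -> k, b' j = \sum_i c i *: b i.
  have : W (b' j) by rewrite WE'; apply: lin_span_mem.
  by rewrite WE => -[c _ <-]; exists c.
have [T TE] := choice T_ex; pose M := \matrix_(j, i) T j i.
suff : row_free M by move/eqP <-; apply: rank_leq_col.
apply/row_freeP; apply/row_freeP; rewrite -kermx_eq0; apply/rowV0P => c.
move/sub_kermxP => cM; apply/rowP => j; rewrite mxE; apply: (fb' (c 0)).
under eq_bigr => i _ do rewrite TE scaler_sumr.
rewrite exchange_big big1 //= => i _.
under eq_bigr => l _ do rewrite scalerA.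
rewrite -scaler_suml; move/rowP/(_ i): cM; rewrite !mxE => cM.
rewrite [X in X *: _](_ : _ = 0) ?scale0r // -[RHS]cM.
by apply: eq_bigr => l _; rewrite mxE.
Qed.

Lemma subspace_dimE W d : has_dim W d -> subspace_dim W = d.
Proof.
by move=> Wd; apply: xget_unique => // d' /(has_dim_inj Wd).
Qed.

(** In coordinates along [b], the preimage of [W] is the row space of a square matrix, whose rows
    map to a spanning family. Keeping the length [m] matters: the generators of an ideal in each
    degree must fit a fixed number of slots. *)
Lemma sub_lin_span m (b : 'I_m -> V) W : subspace W -> W `<=` lin_span b ->
  exists b' : 'I_m -> V, W = lin_span b'.
Proof.
move=> [W0 WD WZ] sW; pose e (c : 'rV[k]_m) := \sum_i c 0 i *: b i.
have eD : {morph e : x y / x + y}.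
  by move=> x y; rewrite -big_split; apply: eq_bigr => i _; rewrite mxE scalerDl.
have eZ a x : e (a *: x) = a *: e x.
  by rewrite scaler_sumr; apply: eq_bigr => i _; rewrite mxE scalerA.
have e0 : e 0 = 0 by rewrite /e big1 // => i _; rewrite mxE scale0r.
have [|B BP] := @subspace_rowspace k m [set c | W (e c)].
  split=> /= [|x y Wx Wy|a x Wx]; first by rewrite e0.
    by rewrite eD; apply: WD.
  by rewrite eZ; apply: WZ.
exists (fun i => e (row i B)); apply/seteqP; split=> [x Wx|_ [c _ <-]].
  have [c _ xE] := sW x Wx; pose c' := \row_i c i.
  have xe : x = e c' by rewrite -xE; apply: eq_bigr => i _; rewrite mxE.
  have /BP/submxP[D DE] : W (e c') by rewrite -xe.
  exists (D 0) => //; rewrite xe DE mulmx_sum_row.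
  by rewrite (big_morph e eD e0); apply: eq_bigr => i _; rewrite eZ.
apply: (big_ind W) => // i _; apply: WZ; apply/BP; exact: row_sub.
Qed.

Lemma has_dim_mx r s (M : 'M[k]_(r, s)) (w : 'I_s -> V) :
  (forall c : 'I_s -> k, \sum_i c i *: w i = 0 -> forall i, c i = 0) ->
  has_dim (range (fun c : 'rV_r => \sum_i (c *m M) 0 i *: w i)) (\rank M).
Proof.
move=> fw; exists (fun i => \sum_j row_base M i j *: w j).
have sumE p (N : 'M_(p, s)) (c : 'I_p -> k) :
    \sum_i c i *: (\sum_j N i j *: w j) = \sum_j (\row_i c i *m N) 0 j *: w j.
  under eq_bigr => i _ do rewrite scaler_sumr.
  rewrite exchange_big; apply: eq_bigr => j _ /=.
  rewrite mxE scaler_suml; apply: eq_bigr => i _.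
  by rewrite mxE scalerA.
split.
  apply/seteqP; split=> _ [c _ <-].
    have /submxP[D DE] : (c *m M <= row_base M)%MS by rewrite eq_row_base submxMl.
    exists (D 0) => //; rewrite sumE DE; apply: eq_bigr => j _.
    by congr ((_ *m _) _ _ *: _); apply/rowP => i; rewrite mxE.
  rewrite sumE; have /submxP[D DE] : (\row_i c i *m row_base M <= M)%MS.
    by rewrite (submx_trans (submxMl _ _)) // eq_row_base.
  by exists D => //; rewrite DE.
move=> c; rewrite sumE => /fw c0 i.
have : \row_i c i *m row_base M = 0.
  by apply/rowP => j; rewrite [RHS]mxE; apply: c0.
have /row_freeP[B BE] := row_base_free M.
move/(congr1 (mulmx^~ B)); rewrite -mulmxA BE mulmx1 mul0mx => /rowP/(_ i).
by rewrite !mxE.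
Qed.

End FinDim.

(** The images of spanning families of the [W t] together span the sum; they are indexed by the
    pairs of a [t] and an index for [W t]. *)
Lemma findim_sum (k : fieldType) (V V' : lmodType k) (T : finType)
    (f : T -> V' -> V) (W : T -> set V') :
  (forall t, linear (f t)) -> (forall t, findim (W t)) ->
  findim [set \sum_t f t (x t) | x in [set x : T -> V' | forall t, W t (x t)]].
Proof.
move=> lf fW.
have f0 t : f t 0 = 0.
  by have := lf t (-1) 0 0; rewrite !scaler0 addr0 scaleN1r addNr.
have fD t : {morph f t : x y / x + y}.
  by move=> x y; have := lf t 1 x y; rewrite !scale1r.
have fE t m (c : 'I_m -> k) (b : 'I_m -> V') :
    f t (\sum_i c i *: b i) = \sum_i c i *: f t (b i).
  rewrite (big_morph (f t) (fD t) (f0 t)); apply: eq_bigr => i _.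
  by have := lf t (c i) (b i) 0; rewrite f0 !addr0.
have /choice[s sE] t : exists s : {m & 'I_m -> V'}, W t = lin_span (projT2 s).
  by have [m [b ->]] := fW t; exists (existT _ m b).
pose b (p : {t : T & 'I_(projT1 (s t))}) := f (tag p) (projT2 (s (tag p)) (tagged p)).
have pairE (c : forall t, 'I_(projT1 (s t)) -> k) :
    \sum_t f t (\sum_i c t i *: projT2 (s t) i) = \sum_p c (tag p) (tagged p) *: b p.
  under eq_bigr => t _ do rewrite fE.
  by rewrite (@sig_big_dep _ _ _ _ (fun t => 'I_(projT1 (s t))) xpredT (fun _ => xpredT)
    (fun t i => c t i *: f t (projT2 (s t) i))).
rewrite (_ : [set _ | _ in _] = lin_span b); first exact: findim_lin_span.
apply/seteqP; split=> [_ [x Wx <-]|_ [c _ <-]].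
  have /(_ _)/cid2-/all_sig2[c _ cE] : forall t,
      exists2 c : 'I_(projT1 (s t)) -> k, True & \sum_i c i *: projT2 (s t) i = x t.
    by move=> t; have := Wx t; rewrite sE => -[c]; exists c.
  exists (fun p => c (tag p) (tagged p)) => //.
  by rewrite -pairE; apply: eq_bigr => t _; rewrite cE.
pose d t (i : 'I_(projT1 (s t))) := c (Tagged (fun t => 'I_(projT1 (s t))) i).
exists (fun t => \sum_i d t i *: projT2 (s t) i).
  by move=> t; rewrite sE; exists (d t).
by rewrite pairE; apply: eq_bigr => -[t i].
Qed.

(** * Local finiteness *)

Section LocallyFinite.
Variables (k : fieldType) (A : algType k) (G : nat -> set A).
Hypothesis hG : connected_graded G.

Let gG := connected_graded_grading hG.

Lemma graded_subspace n : subspace (G n).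
Proof.
split; [exact: (grading0 gG)|exact: (gradingD gG)|].
by move=> a x; apply: (connected_gradedZ hG).
Qed.

Lemma raction_regular : graded_right_action G G *%R.
Proof.
split=> //; [exact: mulrDl|exact: mulr1|by move=> *; rewrite mulrA|].
exact: (connected_gradedM hG).
Qed.

Lemma hpart_mull n e (a x : A) : G e a ->
  hpart G n (a * x) = if (e <= n)%N then a * hpart G (n - e)%N x else 0.
Proof.
move=> Ga; have [Hx [N [x0 xE]]] := hpart_spec gG x.
rewrite {1}xE mulr_sumr (hpart_bigsum gG).
under eq_bigr => i _ do
  rewrite (hpart_homog gG n (connected_gradedM hG Ga (hpartP gG i x))).
case: leqP => [len|ltn]; last first.
  by rewrite big1 // => i _; case: eqP => // nE; lia.
have [ltN|leN] := ltnP (n - e) N; last first.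
  rewrite x0 // mulr0 big1 // => i _; case: eqP => // nE.
  by have := ltn_ord i; lia.
rewrite (bigD1 (Ordinal ltN)) //= subnKC // eqxx big1 ?addr0 // => i ni.
case: eqP => // nE; case/eqP: ni; apply: val_inj => /=; lia.
Qed.

(** The images of the free generators need not be homogeneous, so [h] lists their homogeneous
    components of positive degree. The sums of a scalar and an element of the right ideal of the
    [h t] are stable under left multiplication by these images, hence include the images of all
    monomials. *)
Lemma finitely_generated_homogeneous : finitely_presented A ->
  exists (T : finType) (d : T -> nat) (h : T -> A),
    (forall t, G (d t).+1 (h t)) /\
    forall x, exists (a : k) (z : T -> A), x = a%:A + \sum_t h t * z t.
Proof.
case=> n [phi [_ [_ [/seteqP[_ surj] _]]]].
pose y i := phi << 1 *g fmu i >>.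
have /choice[N NP] i : exists N, y i = \sum_(j < N) hpart G j (y i) by apply: hpart_sum.
(* Index [j] stands for degree [j.+1], hence the predecessor: the component of degree 0 is a scalar
   and is treated separately. *)
pose T := {i : 'I_n & 'I_(N i).-1}.
pose d (t : T) : nat := tagged t.
pose h (t : T) := hpart G (d t).+1 (y (tag t)).
exists T, d, h; split; first by move=> t; apply: hpartP.
pose B x := exists (a : k) (z : T -> A), x = a%:A + \sum_t h t * z t.
have BD u v : B u -> B v -> B (u + v).
  move=> [a [z ->]] [b [w ->]]; exists (a + b), (fun t => z t + w t).
  rewrite scalerDl addrACA; congr (_ + _); rewrite -big_split.
  by apply: eq_bigr => t _; rewrite mulrDr.
have BZ a u : B u -> B (a *: u).
  move=> [b [z ->]]; exists (a * b), (fun t => a *: z t).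
  rewrite scalerDr scalerA scaler_sumr; congr (_ + _).
  by apply: eq_bigr => t _; rewrite scalerAr.
have Bh t x : B (h t * x).
  exists 0, (fun t' => if t' == t then x else 0); rewrite scale0r add0r.
  by rewrite (bigD1 t) //= eqxx big1 ?addr0 // => t' /negbTE ->; rewrite mulr0.
have B0 : B 0.
  by exists 0, (fun=> 0); rewrite scale0r add0r big1 // => t _; rewrite mulr0.
have By i x : B x -> B (y i * x).
  move=> Bx; rewrite (NP i) mulr_suml; case E: (N i) => [|m]; first by rewrite big_ord0.
  rewrite big_ord_recl; apply: (BD) => /=.
    have := hpartP gG 0 (y i); rewrite (connected_graded_deg0 hG) => -[a _ <-].
    by rewrite -scalerAl mul1r; apply: BZ.
  apply: (big_ind B); [exact: B0|by move=> u v; apply: BD|move=> j _].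
  rewrite /bump /= add1n.
  have ltj : (j < (N i).-1)%N by rewrite E.
  exact: (Bh (Tagged (fun i => 'I_(N i).-1) (Ordinal ltj))).
have Bmon c s : B (phi << c *g FMonom s >>).
  elim: s => [|i s IH].
    have -> : << c *g FMonom [::] >> = c *: 1 :> {malg k[{fmonom 'I_n}]}.
      rewrite -mul_malgC mulr1; congr << _ *g _ >>; apply: val_inj.
      by rewrite /= fm1.
    rewrite linearZ rmorph1; exists c, (fun=> 0).
    by rewrite big1 ?addr0 // => t _; rewrite mulr0.
  have -> : << c *g FMonom (i :: s) >> =
      << 1 *g fmu i >> * << c *g FMonom s >> :> {malg k[{fmonom 'I_n}]}.
    rewrite malgM_def fgmulUU mul1r; congr << _ *g _ >>; apply: val_inj.
    by rewrite /= fmM fmU.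
  by rewrite rmorphM; apply: By.
move=> x; have [p _ <-] : range phi x by apply: surj.
rewrite [p]monalgE raddf_sum; apply: (big_ind B); [exact: B0|by move=> u v; apply: BD|].
by case=> s _; apply: Bmon.
Qed.

(** The part of degree [n.+1] is the sum of the products of [h t] with the part of degree [n - d t],
    over [d t <= n], and these parts are finite-dimensional by induction. *)
Lemma locally_finite : finitely_presented A -> forall n, findim (G n).
Proof.
case/finitely_generated_homogeneous=> T [d [h [hd hT]]].
elim/ltn_ind=> -[|n] IH.
  rewrite (connected_graded_deg0 hG); exists 1%N, (fun=> 1).
  apply/seteqP; split=> _ [c _ <-]; last first.
    by exists (c ord0); rewrite ?big_ord1.
  by exists (fun=> c); rewrite ?big_ord1.
pose W (t : T) := if (d t <= n)%N then G (n - d t)%N else [set 0].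
have fW t : findim (W t).
  rewrite /W; case: ifP => _; first by apply: IH; rewrite ltnS leq_subr.
  exists 0%N, (fun=> 0); apply/seteqP; split=> [_ ->|_ [c _ <-]].
    by exists (fun=> 0); rewrite ?big_ord0.
  by rewrite big_ord0.
have lh t : linear ( *%R (h t)) by move=> a x y; rewrite mulrDr scalerAr.
have := findim_sum lh fW.
congr findim; apply/seteqP; split=> [_ [z Wz <-]|x Gx].
  apply: (grading_bigsum gG) => t _; have := Wz t; rewrite /W.
  case: leqP => [le|_ ->]; last by rewrite /= mulr0; apply: (grading0 gG).
  move=> /(connected_gradedM hG (hd t)); congr (G _ _); lia.
have [a [z xE]] := hT x.
exists (fun t => if (d t <= n)%N then hpart G (n - d t)%N (z t) else 0).
  by move=> t; rewrite /W; case: ifP => // _; apply: hpartP.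
rewrite -[RHS](hpart_id gG Gx) xE (hpartD gG) (hpart_bigsum gG).
have G0a : G 0%N a%:A by rewrite (connected_graded_deg0 hG); exists a.
rewrite (hpart_homog gG _ G0a) /= add0r; apply: eq_bigr => t _.
rewrite (hpart_mull _ _ (hd t)) ltnS subSS; case: ifP => // _.
by rewrite /= mulr0.
Qed.

End LocallyFinite.

(** * The family of right ideals generated by a tuple *)

Section FreeModule.
Variables (k : fieldType) (A : algType k) (G : nat -> set A).
Hypothesis hG : connected_graded G.
Variables (T : finType) (d : T -> nat).
Local Notation F := {ffun T -> A}.

Let gG := connected_graded_grading hG.

(* The free right module on homogeneous generators of degrees [d t]. *)
Definition free_grading (n : nat) : set F :=
  [set f | forall t, if (d t <= n)%N then G (n - d t)%N (f t) else f t = 0].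

Definition free_raction (f : F) (a : A) : F := [ffun t => f t * a].

Lemma free_grading_is_grading : is_grading free_grading.
Proof.
split.
- by move=> i t; rewrite ffunE; case: ifP => // _; apply: (grading0 gG).
- move=> i x y Hx Hy t; have := Hx t; have := Hy t; rewrite !ffunE.
  case: ifP => [_ Gy Gx|_ -> ->]; first exact: (gradingB gG).
  by rewrite subr0.
- move=> f.
  have /choice[N NP] t : exists N, forall i, (N <= i)%N -> hpart G i (f t) = 0.
    by have [_ [N [N0 _]]] := hpart_spec gG (f t); exists N.
  pose c n : F := [ffun t => if (d t <= n)%N then hpart G (n - d t)%N (f t) else 0].
  (* From degree [M] on, the shifted components of all entries vanish. *)
  pose M := (\sum_t (N t + d t))%N.
  exists M, c; split.
    by move=> i t; rewrite ffunE; case: ifP => [->|->] //; apply: (hpartP gG).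
  apply/ffunP => t; rewrite sum_ffunE.
  have leM : (N t + d t <= M)%N by rewrite /M (bigD1 t) //= leq_addr.
  have [_ [N' [N'0 ftE]]] := hpart_spec gG (f t).
  have {ftE} -> : f t = \sum_(i < M - d t) hpart G i (f t).
    rewrite {1}ftE; have [le|/ltnW le] := leqP N' (M - d t).
      exact: (bigsum_widen N'0).
    apply/esym; apply: (bigsum_widen (d := fun i => hpart G i (f t))) => // i lei.
    by apply: NP; lia.
  rewrite -(big_mkord xpredT (fun i => c i t)) (@big_cat_nat _ _ _ (d t)) //=; last lia.
  rewrite [X in _ = X + _]big_nat_cond [X in _ = X + _]big1 ?add0r; last first.
    by move=> i /andP[/andP[_ lti] _]; rewrite ffunE leqNgt lti.
  rewrite -[in RHS](add0n (d t)) big_addn big_mkord; apply: eq_bigr => i _.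
  by rewrite ffunE leq_addl addnK.
- move=> N c Hc c0 i ltiN; apply/ffunP => t; rewrite ffunE.
  have := Hc i t; case: leqP => [led|_ //] Gi.
  move/ffunP/(_ t)/(congr1 (hpart G (i - d t))): c0.
  rewrite sum_ffunE ffunE (hpart0 gG) (hpart_bigsum gG) (bigD1 (Ordinal ltiN)) //=.
  rewrite (hpart_id gG Gi) big1 ?addr0 // => j ji.
  have := Hc j t; case: leqP => [led'|_ ->]; last exact: hpart0.
  move/(hpart_homog gG) => ->; case: eqP => // ijE; case/eqP: ji.
  apply: val_inj => /=; lia.
Qed.

Lemma free_raction_graded : graded_right_action G free_grading free_raction.
Proof.
split.
- exact: free_grading_is_grading.
- by move=> x y a; apply/ffunP => t; rewrite !ffunE mulrDl.
- by move=> x; apply/ffunP => t; rewrite !ffunE mulr1.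
- by move=> x a b; apply/ffunP => t; rewrite !ffunE mulrA.
move=> i j x a Hx Ga t; have := Hx t; rewrite ffunE.
case: leqP => [le|lt ->]; last first.
  by rewrite mul0r; case: ifP => // _; apply: (grading0 gG).
rewrite (leq_trans le) ?leq_addr // => Gx.
by rewrite -addnBAC //; apply: (connected_gradedM hG).
Qed.

Lemma free_findim : (forall n, findim (G n)) -> forall n, findim (free_grading n).
Proof.
move=> fG n.
pose e t (y : A) : F := [ffun t' => if t' == t then y else 0].
have le t : linear (e t).
  move=> a x y; apply/ffunP => t'; rewrite !ffunE; case: eqP => // _.
  by rewrite scaler0 addr0.
pose W t := if (d t <= n)%N then G (n - d t)%N else [set 0].
have fW t : findim (W t).
  rewrite /W; case: ifP => // _.
  exists 0%N, (fun=> 0); apply/seteqP; split=> [_ ->|_ [c _ <-]].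
    by exists (fun=> 0); rewrite ?big_ord0.
  by rewrite big_ord0.
have sumE (x : T -> A) t : (\sum_t' e t' (x t')) t = x t.
  rewrite sum_ffunE (bigD1 t) //= ffunE eqxx big1 ?addr0 // => t' nt.
  by rewrite ffunE eq_sym (negbTE nt).
have := findim_sum le fW; congr findim; apply/seteqP; split=> [_ [x Wx <-]|f Hf].
  by move=> t; rewrite sumE; have := Wx t; rewrite /W; case: ifP.
exists f; last by apply/ffunP => t; rewrite sumE.
by move=> t; have := Hf t; rewrite /W; case: ifP.
Qed.

End FreeModule.

Section Family.
Variables (k : fieldType) (A : algType k) (G : nat -> set A).
Hypothesis hG : connected_graded G.
Hypothesis fG : forall n, findim (G n).
Variables (T : finType) (d : T -> nat) (N : nat).
Local Notation F := {ffun T -> A}.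
Local Notation X := (nat -> k).
Local Notation FG := (free_grading G d).
Local Notation ra := (@free_raction k A T).
Local Notation polyfun := (polyfun N).
Local Notation polymx := (polymx N).
Variable g : 'I_N -> F.
Hypothesis hg : forall q t, G (d t) (g q t).

Let gG := connected_graded_grading hG.
Let hra := free_raction_graded hG d.
Let gF := raction_grading hra.

(** The point [x] of affine space stands for the tuple of generators with coordinates [x] along the
    tuples [g q]; its entry at [t] has degree [d t]. The map [family_act x] is the resulting cover
    of the right ideal by the free module, and its kernel consists of the syzygies. *)
Definition family_gen (x : X) (t : T) : A := \sum_(q < N) x q *: g q t.

Definition family_act (x : X) (f : F) : A := \sum_t family_gen x t * f t.

Definition family_ideal (x : X) : set A := range (family_act x).

Definition family_syz (x : X) : set F := [set f | family_act x f = 0].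

Definition family_series (x : X) : nat -> nat := hilbert_series G (family_ideal x).

Lemma family_gen_homog x t : G (d t) (family_gen x t).
Proof. by apply: (grading_bigsum gG) => q _; apply: (connected_gradedZ hG). Qed.

Lemma family_actD x : {morph family_act x : f f' / f + f'}.
Proof.
move=> f f'; rewrite -big_split; apply: eq_bigr => t _.
by rewrite ffunE mulrDr.
Qed.

Lemma family_actZ x a f : family_act x (a *: f) = a *: family_act x f.
Proof. by rewrite scaler_sumr; apply: eq_bigr => t _; rewrite ffunE scalerAr. Qed.

Lemma family_act0 x : family_act x 0 = 0.
Proof. by apply: big1 => t _; rewrite ffunE mulr0. Qed.

Lemma family_act_sum x m (c : 'I_m -> k) (u : 'I_m -> F) :
  family_act x (\sum_i c i *: u i) = \sum_i c i *: family_act x (u i).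
Proof.
rewrite (big_morph (family_act x) (@family_actD x) (family_act0 x)).
by apply: eq_bigr => i _; apply: family_actZ.
Qed.

Lemma family_act_delta x t :
  family_act x [ffun t' => (t' == t)%:R] = family_gen x t.
Proof.
rewrite /family_act (bigD1 t) //= ffunE eqxx mulr1 big1 ?addr0 // => t' nt.
by rewrite ffunE (negbTE nt) mulr0.
Qed.

Lemma family_act_ra x f a : family_act x (ra f a) = family_act x f * a.
Proof. by rewrite mulr_suml; apply: eq_bigr => t _; rewrite ffunE mulrA. Qed.

Lemma family_act_homog x n f : FG n f -> G n (family_act x f).
Proof.
move=> Hf; apply: (grading_bigsum gG) => t _; have := Hf t.
case: leqP => [le Gf|_ ->]; last by rewrite mulr0; apply: (grading0 gG).
by rewrite -(subnKC le); apply: (connected_gradedM hG) => //; apply: family_gen_homog.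
Qed.

Lemma hpart_family_act x n f : hpart G n (family_act x f) = family_act x (hpart FG n f).
Proof.
by apply: hpart_morph => //; [apply: family_actD|move=> i y; apply: family_act_homog].
Qed.

Lemma family_syz_hpart x n f : family_syz x f -> family_syz x (hpart FG n f).
Proof. by move=> Kf; rewrite /family_syz /= -hpart_family_act Kf (hpart0 gG). Qed.

(** In bases of both sides, the degree [n] part of [family_act x] is a matrix whose entries are
    linear forms in the coordinates of [x], since the generators are linear in [x]. *)
Lemma family_presentation n :
  exists (r s : nat) (u : 'I_r -> F) (w : 'I_s -> A) (M : X -> 'M[k]_(r, s)),
  [/\ FG n = lin_span u,
      forall c : 'I_r -> k, \sum_i c i *: u i = 0 -> forall i, c i = 0,
      forall c : 'I_s -> k, \sum_i c i *: w i = 0 -> forall i, c i = 0,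
      polymx M
    & forall x (c : 'rV[k]_r),
        family_act x (\sum_i c 0 i *: u i) = \sum_j (c *m M x) 0 j *: w j].
Proof.
have [r [u [uE fu]]] := findim_has_dim (free_findim d fG n).
have [s [w [wE fw]]] := findim_has_dim (fG n).
have /choice[c cE] (p : 'I_N * 'I_r) : exists c : 'I_s -> k,
    \sum_t g p.1 t * u p.2 t = \sum_j c j *: w j.
  have : G n (\sum_t g p.1 t * u p.2 t).
    have Hu : FG n (u p.2) by rewrite uE; apply: lin_span_mem.
    apply: (grading_bigsum gG) => t _; have := Hu t.
    case: leqP => [le Gf|_ ->]; last by rewrite mulr0; apply: (grading0 gG).
    by rewrite -(subnKC le); apply: (connected_gradedM hG).
  by rewrite wE => -[c _ <-]; exists c.
exists r, s, u, w, (fun x : X => \matrix_(i, j) \sum_(q < N) x q * c (q, i) j).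
split=> //.
  move=> i j; under eq_fun do rewrite mxE.
  apply: polyfun_sum => q; apply: polyfunM; last exact: polyfun_const.
  exact: polyfun_coord.
move=> x b; rewrite family_act_sum.
have actE i : family_act x (u i) = \sum_j (\sum_(q < N) x q * c (q, i) j) *: w j.
  transitivity (\sum_(q < N) x q *: \sum_t g q t * u i t).
    under [RHS]eq_bigr => q _ do rewrite scaler_sumr.
    rewrite exchange_big; apply: eq_bigr => t _ /=.
    by rewrite mulr_suml; apply: eq_bigr => q _; rewrite scalerAl.
  under eq_bigr => q _ do rewrite (cE (q, i)) scaler_sumr.
  rewrite exchange_big; apply: eq_bigr => j _ /=.
  by rewrite scaler_suml; apply: eq_bigr => q _; rewrite scalerA.
under eq_bigr => i _ do rewrite actE scaler_sumr.
rewrite exchange_big; apply: eq_bigr => j _ /=.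
rewrite mxE scaler_suml; apply: eq_bigr => i _.
by rewrite mxE scalerA.
Qed.

(** As [family_act x] commutes with taking homogeneous components, the degree [n] part of its image
    is the image of the degree [n] part, described by [M x]. *)
Lemma has_dim_family_ideal n r s (u : 'I_r -> F) (w : 'I_s -> A)
    (M : X -> 'M[k]_(r, s)) x :
  FG n = lin_span u ->
  (forall c : 'I_s -> k, \sum_i c i *: w i = 0 -> forall i, c i = 0) ->
  (forall c : 'rV[k]_r,
     family_act x (\sum_i c 0 i *: u i) = \sum_j (c *m M x) 0 j *: w j) ->
  has_dim (G n `&` family_ideal x) (\rank (M x)).
Proof.
move=> uE fw actE; have := has_dim_mx (M x) fw; congr has_dim.
apply/seteqP; split=> [_ [c _ <-]|y [Gy [f _ fE]]].
  rewrite -actE; split; last by eexists.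
  apply: family_act_homog; rewrite uE; exists (c 0) => //.
rewrite -(hpart_id gG Gy) -fE hpart_family_act.
have := hpartP gF n f; rewrite uE => -[c _ <-].
exists (\row_i c i) => //; rewrite -actE; congr family_act.
by apply: eq_bigr => i _; rewrite mxE.
Qed.

Lemma family_series_semicontinuous n x :
  exists h, [/\ polyfun h, h x != 0 &
    forall z, h z != 0 -> (family_series x n <= family_series z n)%N].
Proof.
have [r [s [u [w [M [uE fu fw pM actE]]]]]] := family_presentation n.
have HE z := subspace_dimE (has_dim_family_ideal uE fw (actE z)).
have [h [ph hx hz]] := mxrank_semicontinuous x pM.
by exists h; split=> // z; rewrite /family_series /hilbert_series !HE; apply: hz.
Qed.

Lemma family_series_bounded n : exists B, forall x, (family_series x n <= B)%N.
Proof.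
have [r [s [u [w [M [uE fu fw pM actE]]]]]] := family_presentation n.
exists s => x; rewrite /family_series /hilbert_series.
by rewrite (subspace_dimE (has_dim_family_ideal uE fw (actE x))) rank_leq_col.
Qed.

(** * Polynomial families of homogeneous elements and lifting of syzygies *)

Inductive polymap (n : nat) : (X -> F) -> Prop :=
| polymap0 : polymap n (fun=> 0)
| polymap_cons p v S : polyfun p -> FG n v -> polymap n S ->
    polymap n (fun z => p z *: v + S z).

Lemma polymapD n S S' : polymap n S -> polymap n S' ->
  polymap n (fun z => S z + S' z).
Proof.
move=> HS HS'; elim: HS => {S} [|p v S pp Hv _ IH].
  by under eq_fun do rewrite add0r.
by under eq_fun do rewrite -addrA; apply: polymap_cons.
Qed.

Lemma polymap_ra n e S a : polymap n S -> G e a ->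
  polymap (n + e) (fun z => ra (S z) a).
Proof.
move=> HS Ga; elim: HS => {S} [|p v S pp Hv _ IH].
  by under eq_fun do rewrite (raction0l hra); apply: polymap0.
have E z : ra (p z *: v + S z) a = p z *: ra v a + ra (S z) a.
  by apply/ffunP => t; rewrite !ffunE mulrDl scalerAl.
under eq_fun do rewrite E; apply: polymap_cons => //.
exact: (raction_graded hra).
Qed.

Lemma polymap_sum n m (C : X -> 'rV[k]_m) (u : 'I_m -> F) :
  polymx C -> (forall i, FG n (u i)) ->
  polymap n (fun z => \sum_i C z 0 i *: u i).
Proof.
move=> pC Hu; elim: (index_enum _) => [|i r IH].
  by under eq_fun do rewrite big_nil; apply: polymap0.
by under eq_fun do rewrite big_cons; apply: polymap_cons.
Qed.

Lemma polymap_coord n m (u : 'I_m -> F) S : FG n = lin_span u -> polymap n S ->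
  exists C : X -> 'rV[k]_m, polymx C /\ forall z, S z = \sum_i C z 0 i *: u i.
Proof.
move=> uE; elim=> {S} [|p v S pp Hv _ [C [pC SE]]].
  exists (fun=> 0); split; first exact: polymx_const.
  by move=> z; rewrite big1 // => i _; rewrite mxE scale0r.
move: Hv; rewrite uE => -[c _ <-].
exists (fun z => p z *: \row_i c i + C z); split.
  move=> i j; under eq_fun do rewrite !mxE.
  by apply: polyfunD => //; apply: polyfunM => //; apply: polyfun_const.
move=> z; rewrite SE scaler_sumr -big_split; apply: eq_bigr => i _ /=.
by rewrite !mxE scalerDl scalerA.
Qed.

(* The syzygy [f] at the point [x] of the closed set [Z] extends to a polynomial
   family of syzygies on a Zariski neighborhood of [x] in [Z]. *)
Definition liftable (Z : set X) (x : X) (n : nat) (f : F) : Prop :=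
  exists (S : X -> F) h, [/\ polymap n S, polyfun h, h x != 0, S x = f &
    forall z, Z z -> h z != 0 -> family_syz z (S z)].

Lemma liftable0 Z x n : liftable Z x n 0.
Proof.
exists (fun=> 0), (fun=> 1); split=> //; first exact: polymap0.
- exact: polyfun_const.
- exact: oner_neq0.
- by move=> z _ _; apply: family_act0.
Qed.

Lemma liftableD Z x n f f' : liftable Z x n f -> liftable Z x n f' ->
  liftable Z x n (f + f').
Proof.
move=> [S [h [pS ph hx <- SK]]] [S' [h' [pS' ph' hx' <- SK']]].
exists (fun z => S z + S' z), (fun z => h z * h' z); split=> //.
- exact: polymapD.
- exact: polyfunM.
- by rewrite mulf_neq0.
move=> z Zz; rewrite mulf_eq0 negb_or => /andP[hz hz'].
by rewrite /family_syz /= family_actD SK // SK' // addr0.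
Qed.

Lemma liftable_ra Z x n e f a : liftable Z x n f -> G e a ->
  liftable Z x (n + e) (ra f a).
Proof.
move=> [S [h [pS ph hx <- SK]]] Ga.
exists (fun z => ra (S z) a), h; split=> //; first exact: polymap_ra.
by move=> z Zz hz; rewrite /family_syz /= family_act_ra SK // mul0r.
Qed.

(** Lifts can be added and multiplied by homogeneous elements of [A], so lifting the syzygies of
    degree at most [D] lifts all that they generate. *)
Lemma generated_liftable Z x D n f :
  (forall j y, (j <= D)%N -> family_syz x y -> FG j y -> liftable Z x j y) ->
  generated_le G FG ra D (family_syz x) n f -> liftable Z x n f.
Proof.
move=> HD; elim=> {n f} [n|n j s a f jn jD Ks Hs Ga _ IH].
  exact: liftable0.
apply: liftableD => //; rewrite -[X in liftable _ _ X](subnKC jn).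
by apply: liftable_ra => //; apply: HD.
Qed.

(** If the dimension in degree [n] is maximal on [Z] at [x], the rank of [M z] on [Z] never exceeds
    that of [M x], which is the condition under which Cramer's rule lifts a left kernel vector. *)
Lemma syz_liftable (Z : set X) x n f :
  (forall z, Z z -> (family_series z n <= family_series x n)%N) ->
  family_syz x f -> FG n f -> liftable Z x n f.
Proof.
move=> leZ Kf Hf.
have [r [s [u [w [M [uE fu fw pM actE]]]]]] := family_presentation n.
have HE z := subspace_dimE (has_dim_family_ideal uE fw (actE z)).
move: Hf Kf; rewrite uE => -[c _ <-]; pose c' := \row_i c i.
have -> : \sum_i c i *: u i = \sum_i c' 0 i *: u i.
  by apply: eq_bigr => i _; rewrite mxE.
rewrite /family_syz /= actE => /fw cM.
have {cM} /(left_kernel_lift pM)[h [C [ph pC hx Cx hz]]] : c' *m M x = 0.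
  by apply/rowP => j; rewrite [RHS]mxE; apply: cM.
exists (fun z => \sum_i C z 0 i *: u i), h; split=> //; last 1 first.
- move=> z Zz hz0; rewrite /family_syz /= actE hz //.
    by rewrite big1 // => j _; rewrite mxE scale0r.
  by have := leZ z Zz; rewrite /family_series /hilbert_series !HE.
- by apply: polymap_sum => // i; rewrite uE; apply: lin_span_mem.
- by rewrite Cx.
Qed.

(** Lift the rows of the kernel matrix of [M x] to a family [C z] that kills [M z] for [z] near [x]
    in [Z]. The rank of [C z] does not drop near [x], so the left kernel does not shrink and the
    rank of [M z] does not grow. *)
Lemma liftable_semicontinuous (Z : set X) x n :
  (forall f, family_syz x f -> FG n f -> liftable Z x n f) ->
  exists h, [/\ polyfun h, h x != 0 &
    forall z, Z z -> h z != 0 -> (family_series z n <= family_series x n)%N].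
Proof.
move=> lift.
have [r [s [u [w [M [uE fu fw pM actE]]]]]] := family_presentation n.
have HE z := subspace_dimE (has_dim_family_ideal uE fw (actE z)).
have /choice[Ch ChP] (i : 'I_r) : exists Ch : (X -> 'rV[k]_r) * (X -> k),
    [/\ polymx Ch.1, polyfun Ch.2, Ch.2 x != 0, Ch.1 x = row i (kermx (M x)) &
     forall z, Z z -> Ch.2 z != 0 -> Ch.1 z *m M z = 0].
  have [||S [h [pS ph hx Sx SK]]] := lift (\sum_j row i (kermx (M x)) 0 j *: u j).
  - rewrite /family_syz /= actE -row_mul mulmx_ker row0.
    by rewrite big1 // => j _; rewrite mxE scale0r.
  - by rewrite uE; exists (row i (kermx (M x)) 0).
  have [C [pC SE]] := polymap_coord uE pS.
  exists (C, h); split=> //=.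
    apply/rowP => j; apply/eqP; rewrite -subr_eq0; apply/eqP; move: j.
    apply: fu; under eq_bigr => j _ do rewrite scalerBl.
    by rewrite sumrB -SE Sx subrr.
  move=> z Zz hz; apply/rowP => j; rewrite [RHS]mxE; move: j; apply: fw.
  by rewrite -actE -SE; apply: SK.
pose C z := \matrix_i (Ch i).1 z.
have pC : polymx C.
  by move=> i j; under eq_fun do rewrite mxE; case: (ChP i) => p _ _ _ _; apply: p.
have Cx : C x = kermx (M x).
  by apply/row_matrixP => i; rewrite rowK; case: (ChP i).
have [h [ph hx hz]] := mxrank_semicontinuous x pC.
exists (fun z => h z * \prod_i (Ch i).2 z); split.
- by apply: polyfunM => //; apply: polyfun_prod => i; case: (ChP i).
- by rewrite mulf_neq0 //; apply/prodf_neq0 => i _; case: (ChP i).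
move=> z Zz; rewrite mulf_eq0 negb_or => /andP[hz0 /prodf_neq0 Chz].
have CM : C z *m M z = 0.
  apply/row_matrixP => i; rewrite row_mul rowK row0.
  by case: (ChP i) => _ _ _ _; apply => //; apply: Chz.
have := mulmx0_rank_max CM; have := hz z hz0.
rewrite Cx mxrank_ker /family_series /hilbert_series !HE.
have := rank_leq_row (M x); lia.
Qed.

End Family.

(** * Noetherian induction *)

(** Otherwise every set with property [Q] could be cut by a polynomial function that is not
    identically zero on it, keeping [Q]. Iterating from the whole space, the Noetherian property
    gives a step whose function already vanishes on the set that it should cut. *)
Lemma polyfun_minimal_zeros (k : fieldType) (N : nat) (Q : set (nat -> k) -> Prop) :
  Q setT -> exists Z, Q Z /\ forall f, polyfun N f ->
    (exists2 x, Z x & f x != 0) -> ~ Q (Z `&` [set x | f x = 0]).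
Proof.
move=> QT; apply: contrapT => /forallNP Zmin.
have /choice[phi phiP] Z : exists f, Q Z ->
    [/\ polyfun N f, exists2 x, Z x & f x != 0 & Q (Z `&` [set x | f x = 0])].
  have [QZ|] := pselect (Q Z); last by exists (fun=> 0).
  apply: contrapT => /forallNP nf; apply: (Zmin Z); split=> // f pf fx QZf.
  by apply: (nf f).
pose fix Zs n := if n is n'.+1 then Zs n' `&` [set x | phi (Zs n') x = 0] else setT.
have QZs n : Q (Zs n) by elim: n => [//|n /phiP[]].
have [|n nP] := @polyfun_noetherian k N (fun n => phi (Zs n)).
  by move=> n; case: (phiP _ (QZs n)).
have [_ [x Zx px] _] := phiP _ (QZs n); case/eqP: px; apply: nP => i ltin.
have sub j : Zs (i + j).+1 x -> phi (Zs i) x = 0.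
  by elim: j => [|j IH]; [rewrite addn0 => -[]|rewrite addnS => -[/IH]].
by apply: (sub (n - i.+1)%N); rewrite -addSn subnKC.
Qed.

Theorem finite_family_series (k : fieldType) (A : algType k) (G : nat -> set A)
    (T : finType) (d : T -> nat) (N : nat) (g : 'I_N -> {ffun T -> A}) (D : nat) :
  connected_graded G -> (forall n, findim (G n)) ->
  (forall q t, G (d t) (g q t)) ->
  finite_set [set family_series G g x | x in
    [set x | forall n f, family_syz g x f -> free_grading G d n f ->
      generated_le G (free_grading G d) (@free_raction k A T) D (family_syz g x) n f]].
Proof.
move=> hG fG hg; set good := [set x | _]; set H := family_series G g.
apply: contrapT => infH.
have [|Z [QZ Zmin]] := @polyfun_minimal_zeros k N
    (fun Z => ~ finite_set [set H x | x in Z `&` good]).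
  by rewrite setTI.
(* Irreducibility of [Z]: if [f * h] vanished on [Z], then [Z] would be the union of two proper
   closed subsets, each with finitely many series by minimality. *)
have Zirr f h : polyfun N f -> polyfun N h -> (exists2 x, Z x & f x != 0) ->
    (exists2 x, Z x & h x != 0) -> exists2 x, Z x & f x * h x != 0.
  move=> pf ph fx hx; apply: contrapT => fh; apply: QZ.
  have /contrapT finf := Zmin f pf fx; have /contrapT finh := Zmin h ph hx.
  have /sub_finite_set : [set H x | x in Z `&` good] `<=`
      [set H x | x in Z `&` [set x | f x = 0] `&` good] `|`
      [set H x | x in Z `&` [set x | h x = 0] `&` good].
    move=> _ [x [Zx gx] <-]; have [fx0|fx0] := eqVneq (f x) 0.
      by left; exists x.
    right; exists x => //; split=> //; split=> //; apply/eqP.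
    by apply: contrapT => /negP hx0; apply: fh; exists x => //; rewrite mulf_neq0.
  by apply; rewrite finite_setU.
have [x0 Zx0] : exists x, Z x.
  apply: contrapT => /forallNP Z0; apply: QZ.
  rewrite (_ : Z = set0) ?set0I ?image_set0 //.
  by apply/seteqP; split=> // x /Z0.
(* The generic value [r n] is the largest dimension in degree [n] over [Z]; by semicontinuity it is
   attained on a nonempty open subset of [Z]. *)
have /choice[r rP] n : exists r, [/\ forall z, Z z -> (H z n <= r)%N
    & exists h, [/\ polyfun N h, exists2 x, Z x & h x != 0 &
        forall z, h z != 0 -> (r <= H z n)%N]].
  have [B HB] := family_series_bounded hG fG hg n.
  pose P r := `[< exists2 x, Z x & H x n = r >].
  have exP : exists r, P r by exists (H x0 n); apply/asboolP; exists x0.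
  have bP r : P r -> (r <= B)%N by move=> /asboolP[x _ <-]; apply: HB.
  case: (ex_maxnP exP bP) => r /asboolP[x Zx <-] maxr; exists (H x n); split.
    by move=> z Zz; apply: maxr; apply/asboolP; exists z.
  have [h [ph hx hz]] := family_series_semicontinuous hG fG hg n x.
  by exists h; split=> //; exists x.
have /choice[h hP] n : exists h, [/\ polyfun N h, exists2 x, Z x & h x != 0 &
   forall z, h z != 0 -> (r n <= H z n)%N] by case: (rP n).
have rmax n z : Z z -> (H z n <= r n)%N by case: (rP n) => + _; apply.
pose p m z := \prod_(j < m) h j z.
have pp m : polyfun N (p m) by apply: polyfun_prod => j; case: (hP j).
have pZ m : exists2 x, Z x & p m x != 0.
  elim: m => [|m IH]; first by exists x0; rewrite // /p big_ord0 oner_neq0.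
  have [ph hx _] := hP m.
  have [x Zx px] := Zirr _ _ (pp m) ph IH hx.
  by exists x => //; rewrite /p big_ord_recr.
(* Outside the zeros of [p D.+1] every degree up to [D] has the generic dimension. The zeros
   contribute finitely many series, and the other good points will all have the series [r]. *)
have /contrapT finp := Zmin _ (pp D.+1) (pZ D.+1).
apply: QZ; apply: (@sub_finite_set _ _
    ([set H x | x in Z `&` [set x | p D.+1 x = 0] `&` good] `|` [set r])); last first.
  by rewrite finite_setU; split=> //; apply: finite_set1.
move=> _ [x [Zx gx] <-]; have [px|px] := eqVneq (p D.+1 x) 0; first by left; exists x.
right; apply/funext => n.
have lift j f : (j <= D)%N -> family_syz g x f -> free_grading G d j f ->
    liftable G d g Z x j f.
  move=> jD; apply: (syz_liftable hG fG hg) => z Zz.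
  apply: leq_trans (rmax j z Zz) _; case: (hP j) => _ _; apply.
  move/prodf_neq0: px => /(_ (Ordinal (jD : (j < D.+1)%N))); exact.
have [|w [pw wx wz]] := @liftable_semicontinuous _ _ _ hG fG _ _ _ _ hg Z x n.
  by move=> f Kf Hf; apply: (generated_liftable hG lift); apply: gx.
have [ph hx hz] := hP n.
(* By irreducibility some [z] in [Z] is both near [x] and generic in degree [n], so [r n] is at most
   the dimension at [z], hence at most the one at [x]. *)
have [|z Zz] := Zirr _ _ pw ph _ hx; first by exists x.
rewrite mulf_eq0 negb_or => /andP[wz0 hz0].
apply/eqP; rewrite eqn_leq rmax //=.
exact: leq_trans (hz z hz0) (wz z Zz wz0).
Qed.

(** * Generators, relations and resolutions *)

Lemma graded_module_raction (k : fieldType) (A : algType k) (G : nat -> set A)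
    (M : lmodType A^c) (H : nat -> set M) :
  graded_right_module G H ->
  graded_right_action G H (fun (x : M) (a : A) => (a : A^c) *: x).
Proof.
case=> gH HM; split=> //.
- by move=> x y a; rewrite scalerDr.
- by move=> x; apply: scale1r.
- by move=> x a b; rewrite scalerA.
Qed.

Section FreeExtension.
Variables (k : fieldType) (A : algType k) (M : lmodType A^c) (B : Type) (e : B -> M).
Hypothesis free_e : forall (N : nat) (b : 'I_N -> B) (a : 'I_N -> A), injective b ->
  \sum_(i < N) (a i : A^c) *: e (b i) = 0 -> forall i, a i = 0.
Variables (V : zmodType) (ra : V -> A -> V).
Hypothesis raDr : forall v a b, ra v (a + b) = ra v a + ra v b.

(* The linear map extending [v] to the free module with basis [e] is well
   defined. *)
Lemma free_extension_eq0 (v : B -> V) (L : seq (B * A)) :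
  \sum_(l <- L) (l.2 : A^c) *: e l.1 = 0 -> \sum_(l <- L) ra (v l.1) l.2 = 0.
Proof.
have ra0 w : ra w 0 = 0 by apply: (addrI (ra w 0)); rewrite -raDr !addr0.
(* Freeness concerns distinct basis elements, so the terms of [L] with the same basis element are
   collected first; [{classic B}] supplies the equality test. *)
have [s [c [us -> ->]]] : exists (s : seq {classic B}) (c : B -> A), [/\ uniq s,
    \sum_(l <- L) (l.2 : A^c) *: e l.1 = \sum_(b <- s) (c b : A^c) *: e b
  & \sum_(l <- L) ra (v l.1) l.2 = \sum_(b <- s) ra (v b) (c b)].
  elim: L => [|[b a] L [s [c [us eE vE]]]].
    by exists [::], (fun=> 0); rewrite !big_nil.
  rewrite !big_cons /= eE vE.
  pose cb := if (b : {classic B}) \in s then c b else 0.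
  pose c' (b' : B) := if (b' : {classic B}) == b then a + cb else c b'.
  have c'E b' : (b' : {classic B}) != b -> c' b' = c b' by rewrite /c' => /negbTE ->.
  have [bs|bs] := boolP ((b : {classic B}) \in s).
    exists s, c'; rewrite !(big_rem _ bs) /= !addrA.
    have -> : c' b = a + c b by rewrite /c' eqxx /cb bs.
    rewrite raDr scalerDl.
    have sE b' : b' \in rem (b : {classic B}) s -> c' b' = c b'.
      by rewrite mem_rem_uniq // inE => /andP[/c'E].
    by split=> //; congr (_ + _); rewrite !big_seq; apply: eq_bigr => b' /sE ->.
  have sE b' : b' \in s -> c' b' = c b'.
    by move=> b's; apply: c'E; apply: contraNneq bs => <-.
  exists ((b : {classic B}) :: s), c'; rewrite !big_cons /= bs us.
  have -> : c' b = a by rewrite /c' eqxx /cb (negbTE bs) addr0.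
  by split=> //; congr (_ + _); rewrite !big_seq; apply: eq_bigr => b' /sE ->.
have inj : injective (tnth (in_tuple s)) by apply/tuple_uniqP.
rewrite !(big_tnth _ _ s) => /(free_e inj) c0; apply: big1 => i _.
by rewrite c0.
Qed.

End FreeExtension.

Section ResolutionMaps.
Variables (k : fieldType) (A : algType k) (G : nat -> set A) (I : set A).
Variable P : graded_free_resolution G I.

Lemma res_augZ (a : A) (y : res_mod P 0) :
  res_aug P ((a : A^c) *: y) = (res_aug P y : A) * a.
Proof. exact: (linearZ_LR (res_aug P) a y). Qed.

Lemma res_diffZ n (a : A) (y : res_mod P n.+1) :
  res_diff P n ((a : A^c) *: y) = (a : A^c) *: res_diff P n y.
Proof. exact: (linearZ_LR (res_diff P n) a y). Qed.

Lemma res_aug_mem y : I (res_aug P y).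
Proof.
have : range (res_aug P) (res_aug P y) by exists y.
by rewrite (res_range_aug P).
Qed.

Lemma res_aug_diff z : res_aug P (res_diff P 0 z) = 0.
Proof.
have : [set x | res_aug P x = 0] (res_diff P 0 z) by rewrite (res_exact0 P); exists z.
by [].
Qed.

Lemma res_diff_diff n z : res_diff P n (res_diff P n.+1 z) = 0.
Proof.
have : [set x | res_diff P n x = 0] (res_diff P n.+1 z).
  by rewrite (res_exactS P); exists z.
by [].
Qed.

End ResolutionMaps.

(** * From Tor vanishing to generation in degrees at most [D] *)

Section Bridge.
Variables (k : fieldType) (A : algType k) (G : nat -> set A).
Hypothesis hG : connected_graded G.
Variables (D : nat) (I : set A).
Hypothesis hI : graded_right_ideal G I.

Let gG := connected_graded_grading hG.

Lemma right_ideal_bigsum (J : Type) (r : seq J) (F : J -> A) :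
  (forall i, I (F i)) -> I (\sum_(i <- r) F i).
Proof.
by move=> IF; apply: (big_ind I); [apply: (right_ideal0 hI)|apply: (right_idealD hI)|].
Qed.

Lemma right_ideal_hpart n x : I x -> I (hpart G n x).
Proof.
move=> /(right_ideal_graded hI)[N [c [cP ->]]]; rewrite (hpart_bigsum gG).
apply: right_ideal_bigsum => i; rewrite (hpart_homog gG n (proj1 (cP i))).
by case: ifP => _; [case: (cP i)|apply: (right_ideal0 hI)].
Qed.

Lemma right_ideal_subspace n : subspace (G n `&` I).
Proof.
have [G0 GD GZ] := graded_subspace hG n; split.
- by split=> //; apply: (right_ideal0 hI).
- by move=> x y [Gx Ix] [Gy Iy]; split; [apply: GD|apply: (right_idealD hI)].
- move=> a x [Gx Ix]; split; first exact: GZ.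
  by rewrite -[x]mulr1 scalerAr; apply: (right_idealM hI).
Qed.

(** Vanishing of Tor_0 in degree [j] puts the degree [j] part of P_0 into P_0 A_+ plus the image of
    P_1. The augmentation kills the latter, so elements of [I] of degree [j > D] lie in I A_+, and
    Nakayama applies. *)
Lemma ideal_generated_le : generators_in_degrees_le G D I ->
  forall n x, I x -> G n x -> generated_le G G *%R D I n x.
Proof.
move=> genI; apply: (graded_nakayama hG (raction_regular hG)).
  by move=> n x; apply: right_ideal_hpart.
move=> j x ltD Ix Gx; have [P PT] := genI j ltD.
have [p _ px] : range (res_aug P) x by rewrite res_range_aug.
have [fP _] := res_free P 0.
have gP := graded_right_module_grading fP.
have augx : res_aug P (hpart (res_gr P 0) j p) = x.
  rewrite -(hpart_morph (f := res_aug P) j p gP gG) ?px ?(hpart_id gG Gx) //.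
    exact: raddfD.
  by move=> i y; apply: res_aug_gr.
have [|y [z [[M [y' [a [Ga yE]]]] pE]]] := PT (hpart (res_gr P 0) j p).
  by split=> //; apply: (hpartP gP).
rewrite -augx pE raddfD /= res_aug_diff addr0 yE linear_sum.
rewrite (eq_bigr (fun i => (res_aug P (y' i) : A) * a i)); last first.
  by move=> i _; apply: res_augZ.
apply: Aplus_span_bigsum => i; last by have [e e0 Ge] := Ga i; exists e.
exact: res_aug_mem.
Qed.

Section Syzygies.
Variables (T : finType) (d : T -> nat) (N : nat) (g : 'I_N -> {ffun T -> A}).
Local Notation F := {ffun T -> A}.
Local Notation FG := (free_grading G d).
Local Notation ra := (@free_raction k A T).
Hypothesis hg : forall q t, G (d t) (g q t).
Hypothesis hd : forall t, (d t <= D)%N.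
Variable x : nat -> k.
Hypothesis xI : family_ideal g x = I.
Local Notation K := (family_syz g x).

(* Compare the free cover [F -> I] with a resolution [P]: send the generators
   to [P_0] and lift the basis of [P_0] back to [F].  A syzygy [s] of degree
   [> D] lies in [F A_+], so that its image in [P_0] comes from a cycle of
   [P_1]; the difference of [s] with its image under [F -> P_0 -> F] lies in
   [K A_+] as well. *)
Lemma syzygy_Aplus_span : relations_in_degrees_le G D I ->
  forall j s, (D < j)%N -> K s -> FG j s -> Aplus_span G ra K s.
Proof.
move=> relI j s ltD Ks Hs; have [P PT] := relI j ltD.
pose hF := free_raction_graded hG d.
have [fP0 [B [deg [e [_ eP eF]]]]] := res_free P 0.
have aP0 := graded_module_raction fP0; have gP0 := raction_grading aP0.
have [fP1 _] := res_free P 1.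
have gP1 := graded_right_module_grading fP1.
have raDr (f : F) a b : ra f (a + b) = ra f a + ra f b.
  by apply/ffunP => t; rewrite !ffunE mulrDr.
have /choice[p pP] t : exists p, res_gr P 0 (d t) p /\ res_aug P p = family_gen g x t.
  have Gt := family_gen_homog hG hg x t.
  have [q _ qx] : range (res_aug P) (family_gen g x t).
    by rewrite res_range_aug -xI; eexists; [|exact: family_act_delta].
  exists (hpart (res_gr P 0) (d t) q); split; first exact: (hpartP gP0).
  rewrite -(hpart_morph (f := res_aug P) _ _ gP0 gG) ?qx ?(hpart_id gG Gt) //.
    exact: raddfD.
  by move=> i y; apply: res_aug_gr.
have /choice[v vP] b : exists f : F, family_act g x f = res_aug P (e b).
  have act_onto y : I y -> exists f, family_act g x f = y.
    by rewrite -xI => -[f _ <-]; exists f.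
  exact: act_onto (res_aug_mem (e b)).
(* The graph of the linear map from P_0 to [F] extending [v], kept as a relation that is then shown
   to be total and functional. *)
pose R (q : res_mod P 0) (f : F) := exists L : seq (B * A),
  q = \sum_(l <- L) (l.2 : A^c) *: e l.1 /\ f = \sum_(l <- L) ra (v l.1) l.2.
have R0 : R 0 0 by exists [::]; rewrite !big_nil.
have RD q f q' f' : R q f -> R q' f' -> R (q + q') (f + f').
  by move=> [L [-> ->]] [L' [-> ->]]; exists (L ++ L'); rewrite !big_cat.
have Rra q f (a : A) : R q f -> R ((a : A^c) *: q) (ra f a).
  move=> [L [-> ->]]; exists [seq (l.1, @GRing.mul A l.2 a) | l <- L]; rewrite !big_map.
  rewrite scaler_sumr (raction_suml hF); split; apply: eq_bigr => l _ /=.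
    exact: (ractionA aP0).
  exact: (ractionA hF).
have Rsum (J : finType) (q : J -> res_mod P 0) (f : J -> F) (a : J -> A) :
    (forall i, R (q i) (f i)) -> R (\sum_i (a i : A^c) *: q i) (\sum_i ra (f i) (a i)).
  move=> Rqf; elim: (index_enum J) => [|i r IH]; first by rewrite !big_nil.
  by rewrite !big_cons; apply: RD => //; apply: Rra.
have Rtot q : exists f, R q f.
  have [M [b [a ->]]] := eP q; exists (\sum_i ra (v (b i)) (a i)).
  apply: Rsum => i; exists [:: (b i, 1)]; rewrite !big_seq1 /= scale1r.
  by rewrite (raction1 hF).
have Rfun q f f' : R q f -> R q f' -> f = f'.
  move=> Rf /(Rra _ _ (-1)) Rf'; apply/eqP; rewrite -subr_eq0.
  have [L [L0 LE]] := RD _ _ _ _ Rf Rf'.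
  have -> : f - f' = f + ra f' (- 1).
    by congr (_ + _); apply/ffunP => t; rewrite !ffunE mulrN1.
  rewrite LE; apply/eqP; apply: (free_extension_eq0 eF raDr).
  by rewrite -L0 scaleN1r subrr.
have Ract q f : R q f -> family_act g x f = res_aug P q.
  move=> [L [-> ->]]; rewrite linear_sum.
  rewrite (big_morph (family_act g x) (@family_actD _ _ _ _ g x) (family_act0 g x)).
  apply: eq_bigr => l _; rewrite (family_act_ra g x) vP; by rewrite res_augZ.
pose fs := \sum_t (s t : A^c) *: p t.
have fs_aug : res_aug P fs = 0.
  rewrite /fs linear_sum -[RHS]Ks; apply: eq_bigr => t _.
  by rewrite res_augZ (proj2 (pP t)).
have Gs t : G (j - d t)%N (s t).
  by have := Hs t; rewrite (leq_trans (hd t) (ltnW ltD)).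
have fs_gr : res_gr P 0 j fs.
  apply: (grading_bigsum gP0) => t _.
  rewrite -(subnKC (leq_trans (hd t) (ltnW ltD))).
  by apply: (raction_graded aP0) => //; case: (pP t).
have [u' _ u'E] : range (res_diff P 0) fs by rewrite -res_exact0.
pose u := hpart (res_gr P 1) j u'.
have uE : res_diff P 0 u = fs.
  rewrite -(hpart_morph (f := res_diff P 0) _ _ gP1 gP0) ?u'E ?(hpart_id gP0 fs_gr) //.
    exact: raddfD.
  by move=> i y; apply: res_diff_gr.
(* As [d t <= D < j], the entries [s t] have positive degree; so [fs] lies in P_0 A_+, and [u],
   which maps to it, is a cycle to which the vanishing of Tor_1 applies. *)
have [|y [z [[M [y' [a [Ga yE]]]] uyz]]] := PT u.
  split; first exact: (hpartP gP1).
  rewrite /tor_cycles /= uE; exists #|T|, (p \o enum_val), (s \o enum_val); split.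
    move=> i /=; exists (j - d (enum_val i))%N => //.
    by rewrite subn_gt0; apply: leq_ltn_trans ltD.
  rewrite /= -(big_enum_val (fun t => (s t : A^c) *: p t)).
  by apply: eq_bigl => t; rewrite inE.
have {u' u'E uE u uyz yE}fsE : fs = \sum_i (a i : A^c) *: res_diff P 0 (y' i).
  rewrite -uE uyz raddfD /= res_diff_diff addr0 yE linear_sum.
  by apply: eq_bigr => i _; apply: res_diffZ.
have /choice[w wP] i : exists w, R (res_diff P 0 (y' i)) w by apply: Rtot.
have Kw i : K (w i).
  by rewrite /family_syz /= (Ract _ _ (wP i)) res_aug_diff.
have /choice[q qP] t : exists q, R (p t) q by apply: Rtot.
(* Both sides are the image of [fs] in [F], computed from its two expressions. *)
have qw : \sum_t ra (q t) (s t) = \sum_i ra (w i) (a i).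
  by apply: (Rfun fs); [|rewrite fsE]; apply: Rsum.
pose dl t : F := [ffun t' => (t' == t)%:R].
(* The generator [dl t] and the image [q t] of [p t] map to the same element of [I], so [dl t - q t]
   is a syzygy; so is each [w i], and all the coefficients have positive degree. *)
have -> : s = \sum_t ra (dl t - q t) (s t) + \sum_i ra (w i) (a i).
  rewrite -qw -big_split /=; apply/ffunP => t; rewrite sum_ffunE (bigD1 t) //=.
  rewrite big1 ?addr0 => [|t' nt]; rewrite !ffunE.
    by rewrite eqxx -mulrDl subrK mul1r.
  by rewrite -mulrDl subrK eq_sym (negbTE nt) mul0r.
apply: Aplus_spanD; apply: Aplus_span_bigsum => //.
  move=> t; rewrite /family_syz /=.
  have -> : dl t - q t = dl t + ra (q t) (- 1).
    by congr (_ + _); apply/ffunP => t'; rewrite !ffunE mulrN1.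
  rewrite family_actD family_act_ra family_act_delta (Ract _ _ (qP t)) (proj2 (pP t)).
  by rewrite mulrN1 subrr.
move=> t; exists (j - d t)%N => //.
by rewrite subn_gt0; apply: leq_ltn_trans ltD.
Qed.

Lemma syzygy_generated_le : relations_in_degrees_le G D I ->
  forall n f, K f -> FG n f -> generated_le G FG ra D K n f.
Proof.
move=> relI; apply: (graded_nakayama hG (free_raction_graded hG d)).
  by move=> n f; apply: (family_syz_hpart hG hg).
by move=> j f ltD Kf Hf; apply: (syzygy_Aplus_span relI ltD).
Qed.

End Syzygies.

End Bridge.

(** * All the ideals in question as members of one family *)

Lemma family_ideal_generated (k : fieldType) (A : algType k) (G : nat -> set A)
    (D : nat) (I : set A) (T : finType) (N : nat)
    (g : 'I_N -> {ffun T -> A}) (x : nat -> k) :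
  connected_graded G -> graded_right_ideal G I ->
  (forall n y, I y -> G n y -> generated_le G G *%R D I n y) ->
  (forall t, I (family_gen g x t)) ->
  (forall e y, (e <= D)%N -> I y -> G e y -> family_ideal g x y) ->
  family_ideal g x = I.
Proof.
move=> hG hI Igen genI Ile; have gG := connected_graded_grading hG.
have ideal0 : family_ideal g x 0 by exists 0; rewrite // family_act0.
have idealD y z : family_ideal g x y -> family_ideal g x z -> family_ideal g x (y + z).
  by move=> [f _ <-] [f' _ <-]; exists (f + f'); rewrite // family_actD.
apply/seteqP; split=> [_ [f _ <-]|y Iy].
  by apply: (right_ideal_bigsum hI) => t; apply: (right_idealM hI).
have [M ->] := hpart_sum gG y.
apply: (big_ind (family_ideal g x)) => // i _.
elim: (Igen i _ (right_ideal_hpart hG hI i Iy) (hpartP gG i y)) => //.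
move=> n j s a f _ jD Is Gs _ _ IH.
apply: idealD => //; have [h _ <-] := Ile _ _ jD Is Gs.
by exists (free_raction h a); rewrite // family_act_ra.
Qed.

Theorem corollary1p3 (D : nat) (hD : (0 < D)%N) (k : fieldType) (A : algType k)
  (G : nat -> set A) (hG : connected_graded G) (hA : finitely_presented A) :
  finite_set [set hilbert_series G I | I in
    [set I : set A | [/\ graded_right_ideal G I,
                         generators_in_degrees_le G D I
                       & relations_in_degrees_le G D I]]].
Proof.
have fG := locally_finite hG hA; have gG := connected_graded_grading hG.
have /choice[s sE] (e : 'I_D.+1) :
    exists s : {m & 'I_m -> A}, G e = lin_span (projT2 s).
  by have [m [b bE]] := fG e; exists (existT _ m b).
(* One generator slot for each vector of a spanning family of [G e], [e <= D]: enough for a spanning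
   family of the degree [e] part of any ideal. *)
pose T : finType := {e : 'I_D.+1 & 'I_(projT1 (s e))}.
pose d (t : T) : nat := tag t.
have hd t : (d t <= D)%N by rewrite -ltnS ltn_ord.
(* The degree [D] part of the free module with generators of degrees [D - d t]
   consists of the tuples [f] with [f t] of degree [d t]. *)
have [N [g gE]] := free_findim (fun t => (D - d t)%N) fG D.
have homogE f : free_grading G (fun t => (D - d t)%N) D f <-> forall t, G (d t) (f t).
  by split=> Hf t; have := Hf t; rewrite leq_subr subKn.
have hg q t : G (d t) (g q t).
  by apply: (homogE (g q)).1; rewrite gE; apply: lin_span_mem.
apply: sub_finite_set (finite_family_series D hG fG hg).
move=> _ [I [hI genI relI] <-].
suff [x xI] : exists x, family_ideal g x = I.
  exists x; last by rewrite /family_series xI.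
  by move=> n f; apply: (syzygy_generated_le hG hg hd xI).
have /all_sig[b bE] (e : 'I_D.+1) : {b : 'I_(projT1 (s e)) -> A |
    G e `&` I = lin_span b}.
  apply/cid; apply: (sub_lin_span (b := projT2 (s e))).
    exact: right_ideal_subspace.
  by rewrite -sE => y [].
pose z : {ffun T -> A} := [ffun t => b (tag t) (tagged t)].
have zP t : (G (d t) `&` I) (z t) by rewrite ffunE bE; apply: lin_span_mem.
have : lin_span g z by rewrite -gE; apply/homogE => t; case: (zP t).
(* The coordinates of the tuple [z] along [g] give the point; those from [N] on are set to 0. *)
case=> c _ cz; exists (fun q => if insub q is Some q' then c q' else 0).
have genE t : family_gen g (fun q => if insub q is Some q' then c q' else 0) t = z t.
  rewrite -cz sum_ffunE; apply: eq_bigr => q _.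
  by rewrite valK !ffunE.
apply: (family_ideal_generated hG hI (ideal_generated_le hG hI genI)).
  by move=> t; rewrite genE; case: (zP t).
move=> e y leD Iy Gy; pose e' : 'I_D.+1 := Ordinal (leD : (e < D.+1)%N).
have : (G e' `&` I) y by [].
rewrite bE => -[a _ <-].
pose tg (i : 'I_(projT1 (s e'))) : T := Tagged (fun e => 'I_(projT1 (s e))) i.
(* The preimage has the scalar [a i] in the slot of the [i]-th generator of degree [e], and 0 in the
   slots of other degrees. *)
exists [ffun t => \sum_i (if tg i == t then (a i)%:A else 0)] => //.
rewrite /family_act; under eq_bigr => t _ do rewrite genE [X in _ * X]ffunE mulr_sumr.
rewrite exchange_big; apply: eq_bigr => i _ /=.
rewrite (bigD1 (tg i)) //= eqxx big1 ?addr0.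
  by rewrite ffunE /= -scalerAr mulr1.
by move=> t /negbTE nt; rewrite eq_sym nt mulr0.
Qed.
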